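(* Let $\alpha>-1$, $\beta\in\mathbb{R}$, $k^2\in(0,1)$, let $D_n[w(\cdot,k^2)]$ be the Hankel determinant of the weight $w(x,k^2)=(1-x^2)^{\alpha}(1-k^2x^2)^{\beta}$ on $[-1,1]$, and for $n\ge0$ put $$H_{2n}(k^2):=k^2(k^2-1)\frac{d}{dk^2}\log D_{2n}[w(\cdot,k^2)],\qquad H_{2n+1}(k^2):=k^2(k^2-1)\frac{d}{dk^2}\log D_{2n+1}[w(\cdot,k^2)].$$ Then $$\begin{aligned} H_{2n}(k^2)={}&\sigma(k^2,n,-\tfrac12,\alpha,\beta)+\sigma(k^2,n,\tfrac12,\alpha,\beta)+\Big(\frac{\beta^2}2+2n\beta+\frac18\Big)k^2-\frac{\beta}2(2n+\alpha+\beta)+n(n+\alpha),\\ H_{2n+1}(k^2)={}&\sigma(k^2,n+1,-\tfrac12,\alpha,\beta)+\sigma(k^2,n,\tfrac12,\alpha,\beta)+\Big(\frac{\beta^2}2+(2n+1)\beta+\frac18\Big)k^2\\ &-\frac{\beta}2(2n+1+\alpha+\beta)+\frac14(2n+1)(2n+1+2\alpha), \end{aligned}$$ where the function $\sigma=\sigma(k^2,n,a,b,c)$ (defined in the context) satisfies the Jimbo–Miwa–Okamoto $\sigma$-form of Painlevé VI $$\sigma'\big(k^2(k^2-1)\sigma''\big)^2+\Big\{2\sigma'\big(k^2\sigma'-\sigma\big)-(\sigma')^2-\nu_1\nu_2\nu_3\nu_4\Big\}^2=\prod_{i=1}^4\big(\nu_i^2+\sigma'\big),$$ with ${}'$ denoting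 the derivative with respect to $k^2$ and $$\nu_1=\tfrac12(c-a),\quad\nu_2=\tfrac12(c+a),\quad\nu_3=\tfrac12(2n+a+c),\quad\nu_4=\tfrac12(2n+a+2b+c).$$
   Context: For a weight $w$ on an interval $I$, $D_n[w]:=\det\big(\int_I x^{i+j}w(x)\,dx\big)_{i,j=0}^{n-1}$, with $D_0:=1$. For $a>-1$, $b>-1$, $c\in\mathbb{R}$, $k^2\in(0,1)$ let $w_2(x,k^2,a,b,c)=x^a(1-x)^b(1-k^2x)^c$, $x\in[0,1]$. The function $\sigma$ is defined by $$\sigma(k^2,n,a,b,c)=k^2(k^2-1)\frac{d}{dk^2}\log D_n[w_2(\cdot,k^2,a,b,c)]+d_1k^2+d_0,$$ with $d_1=-nc-\frac14(a+c)^2$ and $d_0=-\frac n2(n+a+b)+\frac c4(2n+a+b+c)-\frac{ab}4$. *)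

(* Defs.v *)
From mathcomp Require Import all_boot all_order all_algebra.
From mathcomp Require Import all_classical all_reals all_analysis.

Set Implicit Arguments.
Unset Strict Implicit.
Unset Printing Implicit Defensive.

Import Order.TTheory GRing.Theory Num.Theory.
Import numFieldNormedType.Exports.

Local Open Scope classical_set_scope.
Local Open Scope ring_scope.

(* Throughout, the real variable [t] stands for the squared modulus k^2, so
   that d/dk^2 is [derive1] in [t]. *)

(* For [n = 0] this is the determinant of the empty matrix, i.e. 1. *)
Definition hankel_det (R : realType) (I : set R) (w : R -> R) (n : nat) : R :=
  \det (\matrix_(i < n, j < n)
          \int[@lebesgue_measure R]_(x in I) (x ^+ (i + j) * w x)).

Definition log_hankel (R : realType) (I : set R) (w : R -> R -> R) (n : nat)
    (t : R) : R :=
  ln (hankel_det I (w t) n).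

(* [ln] is 0 on nonpositive reals and [derive1] is total; this predicate says
   that the logarithmic derivative of the determinant at [t] is genuine. *)
Definition log_hankel_derivable (R : realType) (I : set R) (w : R -> R -> R)
    (n : nat) (t : R) : Prop :=
  0 < hankel_det I (w t) n /\ derivable (log_hankel I w n) t 1.

Definition hankel_H (R : realType) (I : set R) (w : R -> R -> R) (n : nat)
    (t : R) : R :=
  t * (t - 1) * (log_hankel I w n)^`()%classic t.

Definition w_sym (R : realType) (alpha beta t x : R) : R :=
  (1 - x ^+ 2) `^ alpha * (1 - t * x ^+ 2) `^ beta.

Definition w2 (R : realType) (a b c t x : R) : R :=
  x `^ a * (1 - x) `^ b * (1 - t * x) `^ c.

Definition sigma (R : realType) (t : R) (n : nat) (a b c : R) : R :=
  let d1 := - n%:R * c - 1 / 4 * (a + c) ^+ 2 in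
  let d0 := - (n%:R / 2) * (n%:R + a + b)
            + c / 4 * (2 * n%:R + a + b + c) - a * b / 4 in
  hankel_H `[0, 1] (w2 a b c) n t + d1 * t + d0.

(* Jimbo-Miwa-Okamoto sigma-form of Painleve VI, for the function [s] at the
   point [t], with the existence of the two derivatives included. *)
Definition JMO_sigma_PVI (R : realType) (nu1 nu2 nu3 nu4 : R) (s : R -> R)
    (t : R) : Prop :=
  [/\ derivable s t 1,
      derivable s^`()%classic t 1 &
      s^`()%classic t * (t * (t - 1) * s^`(2)%classic t) ^+ 2
      + (2 * s^`()%classic t * (t * s^`()%classic t - s t) - (s^`()%classic t) ^+ 2
         - nu1 * nu2 * nu3 * nu4) ^+ 2
      = (nu1 ^+ 2 + s^`()%classic t) * (nu2 ^+ 2 + s^`()%classic t)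
        * (nu3 ^+ 2 + s^`()%classic t) * (nu4 ^+ 2 + s^`()%classic t)].

(* Main.v *)
Require Import Defs.
From HB Require Import structures.
From mathcomp Require Import perm zify.
From mathcomp Require Import all_boot all_order all_algebra.
From mathcomp Require Import all_classical all_reals all_analysis.
From mathcomp Require Import measurable_realfun ring lra.

(** Write [s = 1/t], [x_0 = 0], [x_1 = 1], [x_s = s] for the singular points of
    the weight [w = x^a (1-x)^b (1-t x)^c] and [theta_0 = a], [theta_1 = b],
    [theta_s = c] for its exponents.  Beside the functional L(p) = int p w, the
    proof uses for each singular point a functional E_k, morally
    p |-> theta_k int p w / (x - x_k).  Everything needed about them follows from
    two rules: E_k ((X - x_k) p) = theta_k L p (partial fractions, [polar]) and
    E_0 + E_1 + E_s = - L o d/dx (integration by parts).  The integral for E_s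
    converges; those for E_0 and E_1 diverge when a or b is nonpositive, and
    there the two rules serve as a definition ([em0], [em1]).

    Let P be the monic orthogonal polynomial of degree n and q the polynomial of
    degree n-1 orthogonal to lower degrees with L (X^(n-1) q) = 1.  The pair
    (P, q) solves a linear differential system whose residue at x_k is the
    rank-one matrix A_k = u_k v_k^T with v_k = (- q x_k, P x_k) and
    u_k = (E_k P, E_k q).  All invariants are polynomials in the nine numbers
    c_jk = v_j . u_k = P x_j * E_k q - q x_j * E_k P.  Orthogonality gives
    c_kk = - theta_k ([polar_wronskian]), and the second rule gives that
    A_0 + A_1 + A_s is diagonal with entries n and - n - (a+b+c)
    ([pearson_PP], [pearson_qq], [pearson_Pq]).

    In t the polynomial P, and q up to a scaling, move by a multiple of the
    Christoffel-Darboux kernel at s ([flow_P], [flow_q]), which is the Schlesinger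
    flow of the A_k, and the logarithmic derivative of the Hankel determinant is affine in
    y_k = tr (A_s A_k) for k = 0, 1 ([trace_polar], [polar_cdk_self]).
    These facts are collected in [hankel_schlesinger].  It follows that
    sigma' = - y_0 - (a-c)^2/4 and t (t-1) sigma'' = T2 - T1, where
    T1 = tr (A_0 A_1 A_s) and T2 = tr (A_0 A_s A_1).  Since the residues have
    rank one, T1 T2 is the product of the three traces tr (A_j A_k); since the
    3 x 3 matrix (c_jk) has rank at most two, T1 + T2 is affine in these traces.
    The sigma-form is the identity (T1 - T2)^2 = (T1 + T2)^2 - 4 T1 T2
    ([gram_sigma_form]).

    For the symmetric weight the odd moments vanish, so sorting the indices by
    parity splits the Hankel matrix into two blocks ([det_hankel_parity]); the
    substitution y = x^2 identifies the blocks with the Hankel matrices of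
    [w2] for a = -1/2 and a = 1/2, and logarithmic derivatives add up. *)

Set Implicit Arguments.
Unset Strict Implicit.
Unset Printing Implicit Defensive.

Import Order.TTheory GRing.Theory Num.Theory.
Import numFieldNormedType.Exports.

Local Open Scope classical_set_scope.
Local Open Scope ring_scope.

(** * The Christoffel-Darboux kernel and polar functionals *)

Section DividedDifference.
Context {F : fieldType}.
Implicit Types (p f : {poly F}) (z : F).

Definition divdiff z p : {poly F} := (p - p.[z]%:P) %/ ('X - z%:P).

Lemma mul_divdiff z p : ('X - z%:P) * divdiff z p = p - p.[z]%:P.
Proof. by rewrite mulrC divpK// dvdp_XsubCl /root !hornerE subrr. Qed.

Lemma divdiffE z p : p = p.[z]%:P + ('X - z%:P) * divdiff z p.
Proof. by rewrite mul_divdiff addrC subrK. Qed.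

Lemma size_divdiff z p n : (size p <= n.+1)%N -> (size (divdiff z p) <= n)%N.
Proof.
move=> pn; rewrite size_divp ?polyXsubC_eq0// size_XsubC/= subn1.
have : (size (p - p.[z]%:P : {poly F})%R <= n.+1)%N.
  rewrite (leq_trans (size_polyD _ _))// geq_max pn size_polyN.
  by rewrite (leq_trans (size_polyC_leq1 _)).
by case: (size _).
Qed.

Lemma coef_divdiff_monic z p n : p \is monic -> size p = n.+2 ->
  (divdiff z p)`_n = 1.
Proof.
move=> /monicP pm sp.
have := congr1 (fun r : {poly F} => r`_n.+1) (divdiffE z p).
rewrite coefD coefC/= add0r mulrBl coefB coefXM/= coefCM.
have -> : (divdiff z p)`_n.+1 = 0.
  by apply: nth_default; apply: size_divdiff; rewrite sp.
rewrite mulr0 subr0 => <-.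
by move: pm; rewrite lead_coefE sp.
Qed.

Lemma horner_divdiff_diag z p : (divdiff z p).[z] = p^`().[z].
Proof.
have := congr1 (fun r : {poly F} => r^`().[z]) (divdiffE z p).
by rewrite /= derivD derivC add0r derivM derivXsubC !hornerE subrr mul0r addr0.
Qed.

End DividedDifference.

Lemma scalar_polyZ {F : fieldType} (E : {scalar {poly F}}) a (p : {poly F}) :
  E (a *: p) = a * E p.
Proof. exact: linearZ. Qed.

Lemma scalar_polyD {F : fieldType} (E : {scalar {poly F}}) p r :
  E (p + r) = E p + E r.
Proof. exact: linearD. Qed.

Lemma scalar_polyB {F : fieldType} (E : {scalar {poly F}}) p r :
  E (p - r) = E p - E r.
Proof. exact: linearB. Qed.

(** Partial fractions, abstractly: the rule satisfied by
    [E p = theta * int p w / (x - x0)] when [L p = int p w]. *)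
Definition polar {F : fieldType} (L E : {scalar {poly F}}) (x theta : F) :=
  forall p, E (('X - x%:P) * p) = theta * L p.

(** Evaluating the second factor at the pole: the remainder
    [(X - x) * divdiff x f] is sent back to [L], where orthogonality applies. *)
Lemma polar_mul {F : fieldType} {L E : {scalar {poly F}}} {x theta : F} :
  polar L E x theta ->
  forall u f, E (u * f) = f.[x] * E u + theta * L (u * divdiff x f).
Proof.
move=> EP u f; rewrite {1}[f](divdiffE x) mulrDr scalar_polyD mulrC mul_polyC scalar_polyZ.
by rewrite mulrCA EP.
Qed.

(** Characteristic zero provides enough points. *)
Lemma poly_eq0_horner {F : realFieldType} (f : {poly F}) : (forall z, f.[z] = 0) -> f = 0.
Proof.
move=> f0; apply: (@roots_geq_poly_eq0 _ _ [seq i%:R | i <- iota 0 (size f)]).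
- by apply/allP => z _; rewrite rootE f0.
- by rewrite map_inj_uniq ?iota_uniq//; exact: (mulrIn (oner_neq0 _)).
- by rewrite size_map size_iota.
Qed.

(** [P] plays the monic orthogonal polynomial of degree [n.+1] and [q] the
    element of degree at most [n] dual to the leading coefficient, so that the
    Hankel matrix in the background has order [n.+1]. *)
Section ChristoffelDarboux.
Context {F : realFieldType}.
Implicit Types (f g : {poly F}) (z : F).
Variables (L : {scalar {poly F}}) (n : nat) (P q : {poly F}).
Hypotheses (P_monic : P \is monic) (size_P : size P = n.+2)
  (size_q : (size q <= n.+1)%N).
Hypothesis LP : forall f : {poly F}, (size f <= n.+1)%N -> L (P * f) = 0.
Hypothesis Lq : forall f : {poly F}, (size f <= n.+1)%N -> L (q * f) = f`_n.

(** The Christoffel-Darboux kernel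
    [(P z * q y - q z * P y) / (z - y)], as a polynomial in [y]; the difference
    quotients make it meaningful on the diagonal. *)
Definition cdk z : {poly F} := divdiff z P * q - divdiff z q * P.

Lemma cdkE z : ('X - z%:P) * cdk z = q.[z] *: P - P.[z] *: q.
Proof.
by rewrite /cdk mulrBr !mulrA !mul_divdiff -!mul_polyC; ring.
Qed.

Lemma horner_cdk z x : z != x ->
  (cdk z).[x] = (P.[z] * q.[x] - q.[z] * P.[x]) / (z - x).
Proof.
move=> zx; have := congr1 (horner^~ x) (cdkE z); rewrite !hornerE => h.
apply/eqP; rewrite eq_sym -(inj_eq (mulfI (_ : x - z != 0))) ?subr_eq0 1?eq_sym//.
by rewrite h; apply/eqP; field; rewrite subr_eq0.
Qed.

Lemma size_cdk z : (size (cdk z) <= n.+1)%N.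
Proof.
have [->|k0] := eqVneq (cdk z) 0; first by rewrite size_poly0.
have : (size (('X - z%:P) * cdk z)%R <= n.+2)%N.
  rewrite cdkE (leq_trans (size_polyD _ _))// geq_max size_polyN.
  by rewrite !(leq_trans (size_scale_leq _ _))// ?size_P// (leq_trans size_q).
by rewrite size_monicM ?monicXsubC// size_XsubC.
Qed.

Lemma cdk1 z : L (cdk z) = 1.
Proof.
rewrite /cdk scalar_polyB mulrC Lq; last by apply: size_divdiff; rewrite size_P.
rewrite (coef_divdiff_monic _ P_monic size_P) mulrC LP ?subr0//.
by apply: leq_trans (size_divdiff _ (leq_trans size_q _)) _.
Qed.

(** The kernel reproduces: split [f] at [z]; the constant part is [cdk1], and
    [(X - z) * cdk z] is a combination of [P] and [q], which [L] annihilates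
    against the quotient, whose degree is too small. *)
Lemma cdk_repr z f : (size f <= n.+1)%N -> L (cdk z * f) = f.[z].
Proof.
move=> sf; rewrite {1}[f](divdiffE z) mulrDr scalar_polyD mulrC mul_polyC scalar_polyZ cdk1.
rewrite mulrA [cdk z * _]mulrC cdkE mulrBl scalar_polyB -!scalerAl !scalar_polyZ.
have sg : (size (divdiff z f) <= n)%N by exact: size_divdiff.
rewrite LP ?(leq_trans sg)// Lq ?(leq_trans sg)// nth_default//.
by ring.
Qed.

(** Polynomial identities below are checked by pairing with all test
    polynomials. *)
Lemma functional_nondegenerate f : (size f <= n.+1)%N ->
  (forall g : {poly F}, (size g <= n.+1)%N -> L (f * g) = 0) -> f = 0.
Proof.
move=> sf f0; apply: poly_eq0_horner => z.
by rewrite -(cdk_repr z sf) mulrC f0// size_cdk.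
Qed.

Section OnePole.
Variables (E : {scalar {poly F}}) (x theta : F).
Hypothesis EP : polar L E x theta.

Lemma polar_P f : (size f <= n.+2)%N -> E (P * f) = f.[x] * E P.
Proof. by move=> sf; rewrite (polar_mul EP) LP ?mulr0 ?addr0// size_divdiff. Qed.

Lemma polar_q f : (size f <= n.+1)%N -> E (q * f) = f.[x] * E q.
Proof.
move=> sf; have sg := size_divdiff x sf.
by rewrite (polar_mul EP) Lq ?(leq_trans sg)// nth_default// mulr0 addr0.
Qed.

Lemma polar_qP : E (q * P) = P.[x] * E q + theta.
Proof.
rewrite (polar_mul EP) Lq ?size_divdiff ?size_P//.
by rewrite (coef_divdiff_monic _ P_monic size_P) mulr1.
Qed.

(** The residue has trace [- theta]: compute [E (P * q)] in two ways, evaluating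
    at the pole either [q] or [P]; only the second leaves a remainder, the
    pairing of [q] with the leading coefficient of [P]. *)
Lemma polar_wronskian : P.[x] * E q - q.[x] * E P = - theta.
Proof.
by have := polar_qP; rewrite mulrC polar_P ?(leq_trans size_q)// => ->; ring.
Qed.

(** Move the factor [X - s] of the kernel to [X - x], at the price of
    [L (cdk s) = 1]. *)
Lemma polar_cdk s : (s - x) * E (cdk s) = P.[s] * E q - q.[s] * E P + theta.
Proof.
have : E (('X - s%:P) * cdk s) = E (('X - x%:P) * cdk s) + (x - s) * E (cdk s).
  rewrite -scalar_polyZ -scalar_polyD; congr (E _).
  by rewrite -mul_polyC polyCB; ring.
rewrite EP cdk1 cdkE scalar_polyB !scalar_polyZ => h.
by transitivity (theta - (q.[s] * E P - P.[s] * E q)); [rewrite h|]; ring.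
Qed.

Lemma polar_cdk_diag : E (cdk x) = P^`().[x] * E q - q^`().[x] * E P.
Proof.
have sP : (size (divdiff x P) <= n.+1)%N by rewrite size_divdiff// size_P.
have sq : (size (divdiff x q) <= n.+2)%N.
  by apply: size_divdiff; exact/leqW/leqW.
by rewrite /cdk scalar_polyB ![divdiff _ _ * _]mulrC polar_q// polar_P// !horner_divdiff_diag.
Qed.

End OnePole.

Section Pearson.
Variables (E0 E1 Es : {scalar {poly F}}) (x0 x1 s th0 th1 ths : F).
Hypotheses (EP0 : polar L E0 x0 th0) (EP1 : polar L E1 x1 th1)
  (EPs : polar L Es s ths).
Hypothesis pearson : forall p, E0 p + E1 p + Es p = - L p^`().

(** The three entries below say that the sum of the residues is diagonal with
    first entry [n.+1]; each is the integration by parts rule for a product. *)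
Lemma pearson_PP : P.[x0] * E0 P + P.[x1] * E1 P + P.[s] * Es P = 0.
Proof.
have := pearson (P * P).
rewrite (polar_P EP0) ?(polar_P EP1) ?(polar_P EPs) ?size_P// => ->.
rewrite derivM scalar_polyD mulrC LP ?addr0 ?oppr0//.
by rewrite -ltnS -size_P lt_size_deriv// -size_poly_eq0 size_P.
Qed.

Lemma size_deriv_leq f : (size f <= n.+1)%N -> (size f^`() <= n)%N.
Proof.
move=> sf; have [->|f0] := eqVneq f 0; first by rewrite derivC size_poly0.
by rewrite -ltnS (leq_trans (lt_size_deriv f0)).
Qed.

Lemma pearson_qq : q.[x0] * E0 q + q.[x1] * E1 q + q.[s] * Es q = 0.
Proof.
have := pearson (q * q).
rewrite (polar_q EP0) ?(polar_q EP1) ?(polar_q EPs) ?size_q// => ->.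
have sq := size_deriv_leq size_q.
by rewrite derivM scalar_polyD mulrC Lq ?(leq_trans sq)// nth_default// addr0 oppr0.
Qed.

Lemma pearson_Pq : q.[x0] * E0 P + q.[x1] * E1 P + q.[s] * Es P = - n.+1%:R.
Proof.
have := pearson (P * q).
have sq := size_deriv_leq size_q.
rewrite (polar_P EP0) ?(polar_P EP1) ?(polar_P EPs) ?(leq_trans size_q)// => ->.
rewrite derivM scalar_polyD mulrC Lq ?LP ?(leq_trans sq)//; last first.
  by rewrite -ltnS -size_P lt_size_deriv// -size_poly_eq0 size_P.
rewrite coef_deriv; have /monicP := P_monic; rewrite lead_coefE size_P/= => ->.
by rewrite addr0.
Qed.

(** The linear differential system satisfied by [(P, q)]: reproduce the
    derivative, integrate by parts, and evaluate the kernel at the poles. *)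
Lemma deriv_P_repr z : P^`().[z] =
  - ((cdk z).[x0] * E0 P + (cdk z).[x1] * E1 P + (cdk z).[s] * Es P).
Proof.
rewrite -(cdk_repr z); last first.
  by rewrite -ltnS -size_P lt_size_deriv// -size_poly_eq0 size_P.
have sk := size_cdk z; have sk' := size_deriv_leq sk.
have := pearson (P * cdk z).
rewrite (polar_P EP0) ?(polar_P EP1) ?(polar_P EPs) ?(leq_trans sk)// => ->.
by rewrite derivM scalar_polyD LP ?(leq_trans sk')// addr0 opprK mulrC.
Qed.

Lemma deriv_q_repr z : q^`().[z] =
  - ((cdk z).[x0] * E0 q + (cdk z).[x1] * E1 q + (cdk z).[s] * Es q).
Proof.
rewrite -(cdk_repr z) ?(leq_trans (size_deriv_leq size_q))//.
have sk := size_cdk z; have sk' := size_deriv_leq sk.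
have := pearson (q * cdk z).
rewrite (polar_q EP0) ?(polar_q EP1) ?(polar_q EPs) ?(leq_trans sk)// => ->.
by rewrite derivM scalar_polyD Lq ?(leq_trans sk')// nth_default// addr0 opprK mulrC.
Qed.

(** By [polar_cdk_diag] the left side is a Wronskian at [s], and the
    differential system expresses it by the kernel at the poles.  The term of
    the pole [s] itself cancels; in the others, the product of a determinant of
    two [v] vectors by a determinant of two [u] vectors is a two by two minor of
    the matrix of the [c_jk]. *)
Lemma polar_cdk_self : s != x0 -> s != x1 ->
  let c0 := (P.[s] * E0 q - q.[s] * E0 P) * (P.[x0] * Es q - q.[x0] * Es P) in
  let c1 := (P.[s] * E1 q - q.[s] * E1 P) * (P.[x1] * Es q - q.[x1] * Es P) in
  Es (cdk s) = (ths * th0 - c0) / (s - x0) + (ths * th1 - c1) / (s - x1).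
Proof.
move=> s0 s1 c0 c1.
rewrite (polar_cdk_diag EPs) deriv_P_repr deriv_q_repr (@horner_cdk s x0)// (@horner_cdk s x1)//.
have W0 := polar_wronskian EP0; have W1 := polar_wronskian EP1.
have Ws := polar_wronskian EPs.
rewrite -[ths]opprK -[th0]opprK -[th1]opprK -W0 -W1 -Ws /c0 /c1.
by field; rewrite !subr_eq0 s0 s1.
Qed.

(** [Pd] and [qd] stand for the derivatives of [P] and [q] when [L] moves with
    derivative [gam * L + kap * Es]: the hypotheses are the derivatives of the
    orthogonality relations. *)
Section Flow.
Variables (gam kap : F) (Pd qd : {poly F}).
Hypotheses (size_Pd : (size Pd <= n.+1)%N) (size_qd : (size qd <= n.+1)%N).
Hypothesis LPd : forall f : {poly F}, (size f <= n.+1)%N ->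
  L (Pd * f) + (gam * L (P * f) + kap * Es (P * f)) = 0.
Hypothesis Lqd : forall f : {poly F}, (size f <= n.+1)%N ->
  L (qd * f) + (gam * L (q * f) + kap * Es (q * f)) = 0.

Lemma flow_P : Pd = - (kap * Es P) *: cdk s.
Proof.
apply/eqP; rewrite scaleNr -addr_eq0; apply/eqP.
apply: functional_nondegenerate => [|f sf].
  rewrite (leq_trans (size_polyD _ _))// geq_max size_Pd.
  by rewrite (leq_trans (size_scale_leq _ _))// size_cdk.
rewrite mulrDl scalar_polyD -scalerAl scalar_polyZ cdk_repr//.
have := LPd sf; rewrite LP// (polar_P EPs) ?(leq_trans sf)// => <-.
by ring.
Qed.

Lemma flow_q : qd = - gam *: q - (kap * Es q) *: cdk s.
Proof.
apply/eqP; rewrite -subr_eq0; apply/eqP.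
apply: functional_nondegenerate => [|f sf].
  rewrite (leq_trans (size_polyD _ _))// geq_max size_qd size_polyN/=.
  rewrite (leq_trans (size_polyD _ _))// geq_max size_polyN.
  by rewrite !(leq_trans (size_scale_leq _ _))// size_cdk.
rewrite scaleNr opprD !opprK addrA !mulrDl !scalar_polyD -!scalerAl !scalar_polyZ cdk_repr// Lq//.
have := Lqd sf; rewrite Lq// (polar_q EPs) ?(leq_trans sf)// => h.
by rewrite -[RHS]h; ring.
Qed.

End Flow.

(** The left side is [Es] applied to the reproducing kernel on its diagonal,
    [sum_i k_i(y) y^i].  Replacing [y^i] by [s^i] changes nothing, since
    [(y^i - s^i)/(y - s)] has degree below [i] and so is orthogonal to [k i]. *)
Lemma trace_polar (k : 'I_n.+1 -> {poly F}) :
  (forall i, size (k i) <= n.+1)%N ->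
  (forall i (f : {poly F}), (size f <= n.+1)%N -> L (k i * f) = f`_i) ->
  \sum_(i < n.+1) Es (k i * 'X^i) = Es (cdk s).
Proof.
move=> sk Lk.
have -> : cdk s = \sum_(i < n.+1) s ^+ i *: k i.
  apply/eqP; rewrite -subr_eq0; apply/eqP; apply: functional_nondegenerate.
    rewrite (leq_trans (size_polyD _ _))// geq_max size_cdk size_polyN/=.
    apply: (leq_trans (size_sum _ _ _)); apply/bigmax_leqP => i _.
    by rewrite (leq_trans (size_scale_leq _ _)).
  move=> f sf; rewrite mulrBl scalar_polyB cdk_repr// mulr_suml linear_sum/=.
  rewrite (horner_coef_wide _ sf); apply/eqP; rewrite subr_eq0; apply/eqP.
  by apply: eq_bigr => i _; rewrite -scalerAl scalar_polyZ Lk// mulrC.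
rewrite linear_sum/=; apply: eq_bigr => i _; rewrite scalar_polyZ (polar_mul EPs).
have sX : (size (divdiff s ('X^i : {poly F})) <= i)%N.
  by apply: size_divdiff; rewrite size_polyXn.
rewrite Lk ?(leq_trans sX) ?(ltnW (ltn_ord i))//.
by rewrite nth_default// hornerXn mulr0 addr0.
Qed.

End Pearson.
End ChristoffelDarboux.

(** * Algebra of three rank-one residues *)

(** [Pk], [qk], [Ak], [Bk] are the values [P x_k], [q x_k], [E_k P], [E_k q], and
    [N] is the order of the Hankel matrix. *)
Section ResidueAlgebra.
Context {F : fieldType}.
Variables (a b c N : F).
Variables (P0 q0 A0 B0 P1 q1 A1 B1 Ps qs As Bs : F).
Hypotheses (W0 : P0 * B0 - q0 * A0 = - a) (W1 : P1 * B1 - q1 * A1 = - b)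
  (Ws : Ps * Bs - qs * As = - c).
Hypotheses (SPP : P0 * A0 + P1 * A1 + Ps * As = 0)
  (Sqq : q0 * B0 + q1 * B1 + qs * Bs = 0)
  (SqP : q0 * A0 + q1 * A1 + qs * As = - N).

Let c01 := P0 * B1 - q0 * A1.
Let c10 := P1 * B0 - q1 * A0.
Let c0s := P0 * Bs - q0 * As.
Let cs0 := Ps * B0 - qs * A0.
Let c1s := P1 * Bs - q1 * As.
Let cs1 := Ps * B1 - qs * A1.

Let T1 := c01 * c1s * cs0.
Let T2 := c0s * cs1 * c10.
Let th := a + b + c.

Let aE : a = q0 * A0 - P0 * B0. Proof. by rewrite -[a]opprK -W0; ring. Qed.
Let bE : b = q1 * A1 - P1 * B1. Proof. by rewrite -[b]opprK -W1; ring. Qed.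
Let cE : c = qs * As - Ps * Bs. Proof. by rewrite -[c]opprK -Ws; ring. Qed.
Let NE : N = - (q0 * A0 + q1 * A1 + qs * As). Proof. by rewrite SqP opprK. Qed.

Let e1 : P1 * A1 = - (P0 * A0 + Ps * As).
Proof. by apply/eqP; rewrite -addr_eq0 -[X in _ == X]SPP; apply/eqP; ring. Qed.
Let e2 : q1 * B1 = - (q0 * B0 + qs * Bs).
Proof. by apply/eqP; rewrite -addr_eq0 -[X in _ == X]Sqq; apply/eqP; ring. Qed.

(** The three by three matrix of the [c_jk] is a product through dimension two;
    its determinant, with diagonal [-a, -b, -c], vanishes. *)
Lemma residue_det :
  T1 + T2 = a * b * c - a * (cs1 * c1s) - b * (cs0 * c0s) - c * (c01 * c10).
Proof. by rewrite aE bE cE /T1 /T2 /c01 /c10 /c0s /cs0 /c1s /cs1; ring. Qed.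

Let Br := P0 * A0 * (qs * Bs) - q0 * B0 * (Ps * As).

(** [T1 - T2] is [tr (A_0 [A_1, A_s])].  Replacing [A_1] by the diagonal total
    minus [A_0] and [A_s] leaves the difference [2 N + th] of the two diagonal
    entries times a diagonal entry of [[A_s, A_0]]. *)
Lemma residue_commutator : T1 - T2 = (2 * N + th) * Br.
Proof.
(* the triple product of the traceless parts of the residues *)
have -> : T1 - T2 =
  (q0 * A0 + P0 * B0) * (P1 * A1 * (qs * Bs) - q1 * B1 * (Ps * As))
  - (q1 * A1 + P1 * B1) * (P0 * A0 * (qs * Bs) - q0 * B0 * (Ps * As))
  + (qs * As + Ps * Bs) * (P0 * A0 * (q1 * B1) - q0 * B0 * (P1 * A1)).
  by rewrite /T1 /T2 /c01 /c10 /c0s /cs0 /c1s /cs1; ring.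
by rewrite e1 e2 /th aE bE cE NE /Br; ring.
Qed.

(** [tr (A_0 A_s)], obtained by multiplying [A_0] by the diagonal total.  The
    right side involves the poles 0 and 1 alone, so its derivative in [t] avoids
    the moving pole. *)
Lemma residue_y0 :
  cs0 * c0s = - a ^+ 2 - c01 * c10 + a * (N + th) - (2 * N + th) * (q0 * A0).
Proof.
have -> : cs0 * c0s = P0 * B0 * (Ps * Bs) + q0 * A0 * (qs * As)
   - P0 * A0 * (qs * Bs) - q0 * B0 * (Ps * As) by rewrite /cs0 /c0s; ring.
have -> : c01 * c10 = P0 * B0 * (P1 * B1) + q0 * A0 * (q1 * A1)
   - P0 * A0 * (q1 * B1) - q0 * B0 * (P1 * A1) by rewrite /c01 /c10; ring.
by rewrite e1 e2 /th aE bE cE NE; ring.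
Qed.

Lemma residue_y1 :
  cs1 * c1s = - b ^+ 2 - c01 * c10 + b * (N + th) - (2 * N + th) * (q1 * A1).
Proof.
have f1 : P0 * A0 = - (P1 * A1 + Ps * As).
  by apply/eqP; rewrite -addr_eq0; apply/eqP; rewrite -[RHS]SPP; ring.
have f2 : q0 * B0 = - (q1 * B1 + qs * Bs).
  by apply/eqP; rewrite -addr_eq0; apply/eqP; rewrite -[RHS]Sqq; ring.
have -> : cs1 * c1s = P1 * B1 * (Ps * Bs) + q1 * A1 * (qs * As)
   - P1 * A1 * (qs * Bs) - q1 * B1 * (Ps * As) by rewrite /cs1 /c1s; ring.
have -> : c01 * c10 = P0 * B0 * (P1 * B1) + q0 * A0 * (q1 * A1)
   - P0 * A0 * (q1 * B1) - q0 * B0 * (P1 * A1) by rewrite /c01 /c10; ring.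
by rewrite f1 f2 /th aE bE cE NE; ring.
Qed.

(** The trace of the square of the diagonal total. *)
Lemma residue_trace :
  2 * (c01 * c10 + cs0 * c0s + cs1 * c1s)
  = N ^+ 2 + (N + th) ^+ 2 - a ^+ 2 - b ^+ 2 - c ^+ 2.
Proof.
have y01 : cs0 * c0s + cs1 * c1s
    = - c ^+ 2 + c * (N + th) - (2 * N + th) * (qs * As).
  have -> : cs0 * c0s + cs1 * c1s = (P0 * B0 + P1 * B1) * (Ps * Bs)
     + (q0 * A0 + q1 * A1) * (qs * As)
     - (P0 * A0 + P1 * A1) * (qs * Bs) - (q0 * B0 + q1 * B1) * (Ps * As).
    by rewrite /cs0 /c0s /cs1 /c1s; ring.
  by rewrite e1 e2 /th aE bE cE NE; ring.
have := residue_y0; have := residue_y1; rewrite /th => h1 h0.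
transitivity ((cs0 * c0s + c01 * c10) + (cs1 * c1s + c01 * c10)
   + (cs0 * c0s + cs1 * c1s)); first by ring.
by rewrite y01 h0 h1 /th NE; ring.
Qed.

End ResidueAlgebra.

(** [x], [y0], [y1] are the traces of the products of two residues, [T1] and
    [T2] the traces of the two products of three.  As [dds] is [T1 - T2] up to
    sign, its square is [(T1 + T2)^2 - 4 T1 T2], a polynomial in the traces;
    what remains is a polynomial identity in [a], [b], [c], [N], [y0], [y1]. *)
Lemma gram_sigma_form (F : realFieldType) (a b c N t x y0 y1 T1 T2 s ds dds : F) :
  x + y0 + y1 = (N ^+ 2 + (N + (a + b + c)) ^+ 2 - a ^+ 2 - b ^+ 2 - c ^+ 2) / 2 ->
  T1 + T2 = a * b * c - a * y1 - b * y0 - c * x ->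
  T1 * T2 = x * y0 * y1 ->
  s = (t - 1) * (N * c) + (1 - t) * (y0 - c * a) + (y1 - c * b)
    + (- N * c - 1 / 4 * (a + c) ^+ 2) * t
    + (- (N / 2) * (N + a + b) + c / 4 * (2 * N + a + b + c) - a * b / 4) ->
  ds = - y0 - (a - c) ^+ 2 / 4 ->
  dds = T1 - T2 \/ dds = T2 - T1 ->
  let nu1 := 1 / 2 * (c - a) in let nu2 := 1 / 2 * (c + a) in
  let nu3 := 1 / 2 * (2 * N + a + c) in
  let nu4 := 1 / 2 * (2 * N + a + 2 * b + c) in
  ds * dds ^+ 2
   + (2 * ds * (t * ds - s) - ds ^+ 2 - nu1 * nu2 * nu3 * nu4) ^+ 2
  = (nu1 ^+ 2 + ds) * (nu2 ^+ 2 + ds) * (nu3 ^+ 2 + ds) * (nu4 ^+ 2 + ds).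
Proof.
move=> hx hs hp -> -> hd nu1 nu2 nu3 nu4.
have -> : dds ^+ 2 = (T1 + T2) ^+ 2 - 4 * (T1 * T2) by case: hd => ->; ring.
rewrite hs hp.
have -> : x = (N ^+ 2 + (N + (a + b + c)) ^+ 2 - a ^+ 2 - b ^+ 2 - c ^+ 2) / 2 - y0 - y1.
  by rewrite -hx; ring.
by rewrite /nu1 /nu2 /nu3 /nu4; field.
Qed.

(** The hypotheses are the evolution of [P x_k], [q x_k], [E_k P], [E_k q] at the
    fixed poles 0 and 1, in terms of the values at the moving pole [1/t].  The
    terms in [c / t] come from the scaling of [L] and cancel in the
    invariants. *)
Section Schlesinger.
Context {R : realType}.
Variables (a b c N : R) (p0 q0 e0p e0q p1 q1 e1p e1q : R -> R)
  (Ps qs As Bs t : R).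
Hypotheses (t0 : t != 0) (t1 : 1 - t != 0).
Let k0 := Ps * e0q t - qs * e0p t.
Let k1 := Ps * e1q t - qs * e1p t.
Let w0 := p0 t * qs - q0 t * Ps.
Let w1 := p1 t * qs - q1 t * Ps.
Let d1 := (t * (1 - t))^-1.
Hypotheses (Dp0 : is_derive t 1 p0 (w0 * As / t))
  (Dq0 : is_derive t 1 q0 (w0 * Bs / t - c / t * q0 t))
  (Dp1 : is_derive t 1 p1 (w1 * As * d1))
  (Dq1 : is_derive t 1 q1 (w1 * Bs * d1 - c / t * q1 t))
  (De0p : is_derive t 1 e0p (- (As * k0 + c * e0p t) / t + c / t * e0p t))
  (De0q : is_derive t 1 e0q (- (Bs * k0 + c * e0q t) / t))
  (De1p : is_derive t 1 e1p (- (As * k1 + c * e1p t) * d1 + c / t * e1p t))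
  (De1q : is_derive t 1 e1q (- (Bs * k1 + c * e1q t) * d1)).
Hypotheses (Ws : Ps * Bs - qs * As = - c).

(** [tr (A_0 A_1)] as a function of the deformation parameter. *)
Definition cross01 u := (p0 u * e1q u - q0 u * e1p u) * (p1 u * e0q u - q1 u * e0p u).

Let T1 := (p0 t * e1q t - q0 t * e1p t) * (p1 t * Bs - q1 t * As) * k0.
Let T2 := (p0 t * Bs - q0 t * As) * k1 * (p1 t * e0q t - q1 t * e0p t).

Let cE : c = qs * As - Ps * Bs. Proof. by rewrite -[c]opprK -Ws; ring. Qed.

Lemma is_derive_cross01 : is_derive t 1 cross01 ((T1 - T2) / (1 - t)).
Proof.
rewrite /cross01; apply: is_derive_eq.
rewrite /GRing.scale/= /T1 /T2 /d1 /w0 /w1 /k0 /k1 cE.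
by field; rewrite t0 t1.
Qed.

Lemma is_derive_diag0 : is_derive t 1 (fun u => q0 u * e0p u)
  ((p0 t * e0p t * (qs * Bs) - q0 t * e0q t * (Ps * As)) / t).
Proof.
apply: is_derive_eq; rewrite /GRing.scale/= /d1 /w0 /w1 /k0 /k1 cE.
by field; rewrite t0.
Qed.

Lemma is_derive_diag1 : is_derive t 1 (fun u => q1 u * e1p u)
  ((p1 t * e1p t * (qs * Bs) - q1 t * e1q t * (Ps * As)) / (t * (1 - t))).
Proof.
apply: is_derive_eq; rewrite /GRing.scale/= /d1 /w0 /w1 /k0 /k1 cE.
by field; rewrite t0 t1.
Qed.

End Schlesinger.

(** * Derivatives of determinants and inverse matrices *)

Section OpenUnitInterval.
Context {R : realType}.

Lemma near_itv01 (t : R) : 0 < t < 1 -> \forall u \near t, 0 < u < 1.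
Proof.
move=> t01; have : t \in `]0, 1[ by rewrite in_itv.
by move/near_in_itvoo; apply: filterS => u; rewrite in_itv.
Qed.

Lemma neq_itv01 (t : R) : 0 < t < 1 -> (t != 0) * (1 - t != 0).
Proof. by case/andP => ? ?; rewrite !gt_eqF// subr_gt0. Qed.

End OpenUnitInterval.

Section DerivativeDeterminant.
Context {R : realType}.

Lemma is_derive_bigsum (I : Type) (r : seq I) (h : I -> R -> R) (dh : I -> R) (t : R) :
  (forall i, is_derive t 1 (h i) (dh i)) ->
  is_derive t 1 (fun u => \sum_(i <- r) h i u) (\sum_(i <- r) dh i).
Proof.
move=> hd; elim: r => [|i r IH].
  rewrite big_nil [X in is_derive _ _ X _](_ : _ = cst 0).
    exact: is_derive_cst.
  by apply/funext => u; rewrite big_nil.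
rewrite big_cons [X in is_derive _ _ X _](_ : _ =
  h i \+ (fun u => \sum_(i <- r) h i u)); first exact: is_deriveD.
by apply/funext => u; rewrite big_cons.
Qed.

Lemma is_derive_bigprod (I : eqType) (r : seq I) (h : I -> R -> R)
    (dh : I -> R) (t : R) : uniq r ->
  (forall i, is_derive t 1 (h i) (dh i)) ->
  is_derive t 1 (fun u => \prod_(i <- r) h i u)
    (\sum_(i <- r) dh i * \prod_(k <- r | i != k) h k t).
Proof.
move=> + hd; elim: r => [_|i r IH /= /andP[ir ur]].
  rewrite big_nil [X in is_derive _ _ X _](_ : _ = cst 1).
    exact: is_derive_cst.
  by apply/funext => u; rewrite big_nil.
rewrite [X in is_derive _ _ X _](_ : _ =
  h i * (fun u => \prod_(i <- r) h i u)); last first.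
  by apply/funext => u; rewrite big_cons.
apply: is_derive_eq; first exact: is_deriveM (IH ur).
rewrite big_cons big_cons eqxx/= addrC; congr (_ + _).
  rewrite /GRing.scale/= mulrC; congr (_ * _); rewrite big_seq_cond [RHS]big_seq_cond.
  apply: eq_bigl => k; case kr: (k \in r) => //=.
  by apply/esym/negP => /eqP ik; rewrite ik kr in ir.
rewrite /GRing.scale/= mulr_sumr [LHS]big_seq [RHS]big_seq; apply: eq_bigr => j jr.
rewrite big_cons ifT; last by apply/eqP => ji; rewrite -ji jr in ir.
by rewrite mulrCA.
Qed.

(** Jacobi formula: differentiate the Leibniz expansion factor by factor and
    group the permutations by the image of the differentiated row. *)
Lemma is_derive_det (n : nat) (A : R -> 'M[R]_n) (dA : 'M[R]_n) (t : R) :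
  (forall i j, is_derive t 1 (fun u => A u i j) (dA i j)) ->
  is_derive t 1 (fun u => \det (A u))
    (\sum_i \sum_j dA i j * cofactor (A t) i j).
Proof.
move=> hA; rewrite [X in is_derive _ _ X _](_ : _ =
  fun u => \sum_(s : 'S_n) (-1) ^+ s * \prod_i A u i (s i)); last by [].
have hd (s : 'S_n) : is_derive t 1
    (fun u => (-1) ^+ s * \prod_i A u i (s i))
    ((-1) ^+ s * \sum_i dA i (s i) * \prod_(k | i != k) A t k (s k)).
  apply: (@is_deriveZ _ _ _ (fun u => \prod_i A u i (s i)) ((-1) ^+ s)).
  exact: (@is_derive_bigprod _ _ (fun i u => A u i (s i)) _ _ (index_enum_uniq _)).
apply: is_derive_eq; first exact: is_derive_bigsum.
under eq_bigr do rewrite mulr_sumr.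
rewrite exchange_big/=; apply: eq_bigr => i _.
under [RHS]eq_bigr do rewrite expand_cofactor mulr_sumr.
rewrite (exchange_big_dep predT)//=; apply: eq_bigr => s _.
under [RHS]eq_bigl do rewrite eq_sym.
by rewrite big_pred1_eq mulrCA.
Qed.

Lemma derivable_invmx (n : nat) (A : R -> 'M[R]_n) (t : R) :
  (\forall u \near t, \det (A u) != 0) ->
  (forall i j, derivable (fun u => A u i j) t 1) ->
  forall i j, derivable (fun u => invmx (A u) i j) t 1.
Proof.
move=> nzA hA i j.
have hdet m (B : R -> 'M[R]_m) : (forall i j, derivable (fun u => B u i j) t 1) ->
    derivable (fun u => \det (B u)) t 1.
  move=> hB; pose dB := \matrix_(i, j) 'D_1 (fun u => B u i j) t.
  have hBd k l : is_derive t 1 (fun u => B u k l) (dB k l).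
    by rewrite mxE; exact: derivableP.
  exact: (@ex_derive _ _ _ _ _ _ _ (is_derive_det hBd)).
apply: (@near_eq_derivable R R R
  (fun u => (\det (A u))^-1 * cofactor (A u) j i) (fun u => invmx (A u) i j)).
  near=> u.
  have dA : \det (A u) != 0 by near: u; exact: nzA.
  by rewrite /invmx unitmxE unitfE dA !mxE.
apply: derivableM.
  by apply: derivableV; [exact: nbhs_singleton nzA|exact: hdet].
apply: (@derivableZ _ _ _ (fun u => \det (row' j (col' i (A u))))).
apply: hdet => k l.
have -> : (fun u => row' j (col' i (A u)) k l) = (fun u => A u (lift j k) (lift i l)).
  by apply/funext => u; rewrite !mxE.
exact: hA.
Unshelve. all: by end_near. Qed.

End DerivativeDeterminant.

(** * Functionals given by moments *)

Section MomentFunctional.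
Context {F : fieldType}.
Implicit Types (m e : nat -> F) (p f : {poly F}).

Definition momfun m p : F := \sum_(i < size p) p`_i * m i.

Lemma momfun_wide m p k : (size p <= k)%N -> momfun m p = \sum_(i < k) p`_i * m i.
Proof.
move=> pk; rewrite /momfun (big_ord_widen _ (fun i => p`_i * m i) pk) big_mkcond.
apply: eq_bigr => i _; case: ltnP => // h; by rewrite nth_default// mul0r.
Qed.

Lemma momfun_is_scalar m : scalar (momfun m).
Proof.
move=> a p r; set k := maxn (size p) (size r).
have hp : (size p <= k)%N by exact: leq_maxl.
have hr : (size r <= k)%N by exact: leq_maxr.
rewrite (@momfun_wide _ _ k); last first.
  rewrite (leq_trans (size_polyD _ _))// geq_max hr andbT.
  exact: leq_trans (size_scale_leq _ _) hp.
rewrite (momfun_wide _ hp) (momfun_wide _ hr) mulr_sumr -big_split/=.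
by apply: eq_bigr => i _; rewrite coefD coefZ mulrDl mulrA.
Qed.

HB.instance Definition _ m :=
  GRing.isLinear.Build F {poly F} F _ (momfun m) (momfun_is_scalar m).

Lemma momfunXn m j : momfun m 'X^j = m j.
Proof.
rewrite /momfun size_polyXn big_ord_recr/= coefXn eqxx mul1r big1 ?add0r// => i _.
by rewrite coefXn ltn_eqF// mul0r.
Qed.

Lemma momfun_mulXn m p l : momfun m (p * 'X^l) = momfun (fun i => m (i + l)%N) p.
Proof.
rewrite (@momfun_wide _ _ (l + size p)); last first.
  by rewrite (leq_trans (size_polyMleq _ _))// size_polyXn addnS/= addnC.
rewrite big_split_ord/= big1 ?add0r => [|i _]; last first.
  by rewrite coefMXn ltn_ord mul0r.
apply: eq_bigr => i _.
by rewrite coefMXn ltnNge leq_addr/= addKn addnC.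
Qed.

Lemma momfun_mul_expand m p f k : (size f <= k)%N ->
  momfun m (p * f) = \sum_(l < k) f`_l * momfun m (p * 'X^l).
Proof.
move=> fk; rewrite -{1}[f]coefK poly_def mulr_sumr linear_sum/=.
rewrite (big_ord_widen _ (fun i => momfun m (p * (f`_i *: 'X^i))) fk) big_mkcond.
apply: eq_bigr => i _; rewrite -scalerAr scalar_polyZ; case: ltnP => // h.
by rewrite nth_default// mul0r.
Qed.

Lemma horner_momfun p x : p.[x] = momfun (fun i => x ^+ i) p.
Proof. by rewrite horner_coef. Qed.

Lemma momfun_ext m1 m2 : m1 =1 m2 -> momfun m1 =1 momfun m2.
Proof. by move=> h p; apply: eq_bigr => i _; rewrite h. Qed.

(** On moments, both rules become recurrences. *)
Lemma polar_momfun m e x th : (forall j, e j.+1 = x * e j + th * m j) ->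
  polar (momfun m) (momfun e) x th.
Proof.
move=> h p.
have -> : ('X - x%:P) * p = p * 'X^1 - x *: p by rewrite -mul_polyC expr1; ring.
rewrite scalar_polyB scalar_polyZ /= momfun_mulXn (@momfun_ext _ (fun i => x * e i + th * m i)).
  rewrite /momfun !mulr_sumr -sumrB; apply: eq_bigr => i _; ring.
by move=> i; rewrite addn1 h.
Qed.

Lemma pearson_momfun m e0 e1 es :
  (forall j, e0 j + e1 j + es j = - (j%:R * m j.-1)) ->
  forall p, momfun e0 p + momfun e1 p + momfun es p = - momfun m p^`().
Proof.
move=> h p; rewrite (@momfun_wide m p^`() (size p)); last first.
  by rewrite (leq_trans (size_poly _ _)) ?leq_pred.
transitivity (- \sum_(i < (size p).+1) p`_i * (i%:R * m i.-1)).
  rewrite big_ord_recr/= [p`_(size p)]nth_default// mul0r addr0.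
  rewrite /momfun -!big_split/= -sumrN; apply: eq_bigr => i _.
  by rewrite -!mulrDr h mulrN.
rewrite big_ord_recl/= mul0r mulr0 add0r; congr (- _); apply: eq_bigr => i _.
by rewrite coef_deriv /bump/= add0n mulrA mulr_natr.
Qed.

End MomentFunctional.

Section HankelOrthogonalPolynomials.
Context {F : fieldType}.
Variables (m : nat -> F) (n : nat).

Definition hankel_mx : 'M[F]_n.+1 := \matrix_(i, j) m (i + j)%N.

(** The basis dual to the monomials for the pairing [L (p * r)]; its last element
    is [q], and projecting the next monomial along this basis gives [P]. *)
Definition hankel_dual (i : 'I_n.+1) : {poly F} :=
  \poly_(j < n.+1) invmx hankel_mx i (inord j).

Definition hankel_q : {poly F} := hankel_dual ord_max.

Definition hankel_P : {poly F} :=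
  'X^(n.+1) - \sum_(i < n.+1) m (n.+1 + i)%N *: hankel_dual i.

Lemma size_hankel_dual i : (size (hankel_dual i) <= n.+1)%N.
Proof. exact: size_poly. Qed.

Lemma coef_hankel_dual i (j : 'I_n.+1) : (hankel_dual i)`_j = invmx hankel_mx i j.
Proof. by rewrite coef_poly ltn_ord inord_val. Qed.

Lemma size_hankel_sum (c : 'I_n.+1 -> F) :
  (size (\sum_(i < n.+1) c i *: hankel_dual i)%R <= n.+1)%N.
Proof.
apply: (leq_trans (size_sum _ _ _)); apply/bigmax_leqP => i _.
by rewrite (leq_trans (size_scale_leq _ _))// size_hankel_dual.
Qed.

Lemma size_hankel_P : size hankel_P = n.+2.
Proof.
rewrite /hankel_P size_polyDl size_polyXn// size_polyN ltnS.
exact: (size_hankel_sum (fun i => m (n.+1 + i)%N)).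
Qed.

Lemma hankel_P_monic : hankel_P \is monic.
Proof.
rewrite monicE lead_coefE size_hankel_P /= coefB coefXn eqxx.
rewrite [X in _ - X]nth_default ?subr0//.
exact: (size_hankel_sum (fun i => m (n.+1 + i)%N)).
Qed.

Hypothesis hU : \det hankel_mx != 0.

Lemma hankel_dualXn i (l : 'I_n.+1) :
  momfun m (hankel_dual i * 'X^l) = (i == l)%:R.
Proof.
rewrite momfun_mulXn (momfun_wide _ (size_hankel_dual i)).
have := congr1 (fun M : 'M[F]_n.+1 => M i l) (@mulVmx _ _ hankel_mx _).
rewrite unitmxE unitfE hU !mxE => /(_ isT) <-.
by apply: eq_bigr => j _; rewrite coef_hankel_dual mxE.
Qed.

Lemma hankel_dual_mul i (f : {poly F}) : (size f <= n.+1)%N ->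
  momfun m (hankel_dual i * f) = f`_i.
Proof.
move=> sf; rewrite (momfun_mul_expand _ _ sf) (bigD1 i)//= hankel_dualXn eqxx mulr1.
rewrite big1 ?addr0// => l li.
by rewrite hankel_dualXn eq_sym (negbTE li) mulr0.
Qed.

Lemma hankel_q_mul (f : {poly F}) : (size f <= n.+1)%N ->
  momfun m (hankel_q * f) = f`_n.
Proof. exact: hankel_dual_mul. Qed.

Lemma hankel_P_mul (f : {poly F}) : (size f <= n.+1)%N ->
  momfun m (hankel_P * f) = 0.
Proof.
move=> sf; rewrite (momfun_mul_expand _ _ sf) big1// => l _.
rewrite mulrBl -exprD scalar_polyB /= momfunXn mulr_suml linear_sum (bigD1 l)//=.
rewrite -scalerAl scalar_polyZ /= hankel_dualXn eqxx mulr1 big1 ?addr0 ?subrr ?mulr0//.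
move=> i il; rewrite -scalerAl scalar_polyZ /= hankel_dualXn (negbTE il).
by rewrite mulr0.
Qed.

End HankelOrthogonalPolynomials.

(** * Deformation of the orthogonal polynomials *)

Section TimeDependentFunctional.
Context {R : realType}.

Lemma is_derive_momfun (k : nat) (e : R -> nat -> R) (ed : nat -> R)
    (p : R -> {poly R}) (pd : {poly R}) (t : R) :
  (forall u, size (p u) <= k)%N -> (size pd <= k)%N ->
  (forall j, is_derive t 1 (fun u => (p u)`_j) pd`_j) ->
  (forall j, is_derive t 1 (e^~ j) (ed j)) ->
  is_derive t 1 (fun u => momfun (e u) (p u)) (momfun (e t) pd + momfun ed (p t)).
Proof.
move=> sp spd hp he.
rewrite (momfun_wide _ spd) (momfun_wide _ (sp t)) -big_split/=.
rewrite [X in is_derive _ _ X _](_ : _ = fun u => \sum_(i < k) (p u)`_i * e u i).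
  apply: is_derive_bigsum => i; apply: is_derive_eq.
  by rewrite /GRing.scale/=; ring.
by apply/funext => u; rewrite (momfun_wide _ (sp u)).
Qed.

Lemma is_derive_horner (k : nat) (p : R -> {poly R}) (pd : {poly R}) (t x : R) :
  (forall u, size (p u) <= k)%N -> (size pd <= k)%N ->
  (forall j, is_derive t 1 (fun u => (p u)`_j) pd`_j) ->
  is_derive t 1 (fun u => (p u).[x]) pd.[x].
Proof.
move=> sp spd hp.
have -> : (fun u => (p u).[x]) = (fun u => momfun (fun i => x ^+ i) (p u)).
  by apply/funext => u; rewrite horner_momfun.
have h := is_derive_momfun sp spd hp (fun j => is_derive_cst (x ^+ j) t 1).
apply: (is_derive_eq h); rewrite -horner_momfun [X in _ + X]big1 ?addr0// => i _.
by rewrite mulr0.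
Qed.

Lemma is_derive_inv (u : R) : u != 0 ->
  is_derive u 1 (fun v : R => v^-1) (- u ^- 2).
Proof.
move=> u0; split; first exact: (@derivableV _ _ id).
by rewrite (@deriveV _ _ id)// derive_id scaler1.
Qed.

End TimeDependentFunctional.

(** What is retained of the weight: [m] are the moments of [L], [es] those of the
    polar functional at [1/u].  The first hypothesis is the derivative of the
    weight in the parameter, [esS] the partial fraction rule at [1/u],
    [pearson_m] integration by parts, and [des0] the derivative of the one
    moment that the others do not determine. *)
Section MomentSystem.
Context {R : realType}.
Variables (a b c : R) (m es : R -> nat -> R) (n : nat).

Hypothesis dm : forall (u : R) (j : nat), 0 < u < 1 ->
  is_derive u 1 (m^~ j) (c / u * m u j + es u j / u ^+ 2).
Hypothesis esS : forall (u : R) (j : nat), 0 < u < 1 -> es u j.+1 = es u j / u + c * m u j.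
Hypothesis pearson_m : forall (u : R) (j : nat), 0 < u < 1 ->
  (j.+1%:R + a) * (m u j - m u j.+1) - (b + 1) * m u j.+1
  + es u j.+1 - es u j.+2 = 0.
Hypothesis des0 : forall u : R, 0 < u < 1 ->
  is_derive u 1 (es^~ 0)
    (((a - (a + b + c) / u) * es u 0 - (1 + a + b + c) * c * m u 0) / (1 - u)).
Hypothesis D_gt0 : forall u : R, 0 < u < 1 -> 0 < \det (hankel_mx (m u) n).

(** The values of [E_1] and [E_0] on monomials, determined by the partial
    fraction rule up to their value at 1; these two values are the solution of
    the integration by parts rule for [1] and [X]. *)
Definition em1 u : nat -> R := fix f j :=
  if j is j'.+1 then f j' + b * m u j'
  else - (1 + a + b + c) * m u 0 - es u 0 / u.

Definition em0 u j : R :=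
  if j is j'.+1 then a * m u j' else - em1 u 0 - es u 0.

Let D_neq0 (u : R) : 0 < u < 1 -> \det (hankel_mx (m u) n) != 0.
Proof. by move/D_gt0; rewrite lt0r => /andP[]. Qed.

Lemma polar_em0 u : polar (momfun (m u)) (momfun (em0 u)) 0 a.
Proof. by apply: polar_momfun => j /=; rewrite mul0r add0r. Qed.

Lemma polar_em1 u : polar (momfun (m u)) (momfun (em1 u)) 1 b.
Proof. by apply: polar_momfun => j /=; rewrite mul1r. Qed.

Lemma polar_es u : 0 < u < 1 -> polar (momfun (m u)) (momfun (es u)) u^-1 c.
Proof. by move=> u01; apply: polar_momfun => j; rewrite esS// mulrC. Qed.

Lemma pearson_em u : 0 < u < 1 -> forall p,
  momfun (em0 u) p + momfun (em1 u) p + momfun (es u) p = - momfun (m u) p^`().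
Proof.
move=> u01; apply: pearson_momfun; case=> [|j].
  by rewrite /= mul0r oppr0; ring.
elim: j => [|j IH].
  by rewrite /= esS//; field; case/andP: u01 => /lt0r_neq0.
have -> : em0 u j.+2 + em1 u j.+2 + es u j.+2 =
   (em0 u j.+1 + em1 u j.+1 + es u j.+1)
   + (a * (m u j.+1 - m u j) + b * m u j.+1 + es u j.+2 - es u j.+1).
  by rewrite /=; ring.
rewrite IH/=; apply/eqP; rewrite eq_sym -subr_eq0 -[X in _ == X](pearson_m j u01).
by rewrite -!natr1; apply/eqP; ring.
Qed.

Lemma is_derive_em0 (u : R) j : 0 < u < 1 ->
  is_derive u 1 (em0^~ j) (a / u * es u j).
Proof.
move=> u01; have [u0 u1] := neq_itv01 u01.
have dm0 := dm 0 u01; have de := des0 u01.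
case: j => [|j] /=.
  have di := is_derive_inv u0.
  rewrite /em0/=; apply: is_derive_eq; rewrite /GRing.scale/=.
  by field; rewrite u0 u1.
have dmj := dm j u01.
rewrite /em0/=; apply: is_derive_eq; rewrite /GRing.scale/= esS//.
by field.
Qed.

(** Formally, [1/(x - 1)] times the logarithmic derivative of the weight in [u],
    decomposed into partial fractions; proved by induction along the recurrence
    from the case [j = 0], which uses [des0]. *)
Lemma is_derive_em1 (u : R) j : 0 < u < 1 ->
  is_derive u 1 (em1^~ j)
    (c / u * em1 u j - (c * em1 u j - b * es u j) / (u * (1 - u))).
Proof.
move=> u01; have [u0 u1] := neq_itv01 u01.
have dm0 := dm 0 u01; have de := des0 u01.
elim: j => [|j IH] /=.
  have di := is_derive_inv u0.
  apply: is_derive_eq; rewrite /GRing.scale/=.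
  by field; rewrite u0 u1.
have dmj := dm j u01.
apply: is_derive_eq; rewrite /GRing.scale/= esS//.
by field; rewrite u0 u1.
Qed.


Let Dn u := \det (hankel_mx (m u) n).
Let P u := hankel_P (m u) n.
Let q u := hankel_q (m u) n.

Lemma derivable_dual (t : R) (i : 'I_n.+1) j : 0 < t < 1 ->
  derivable (fun u => (hankel_dual (m u) i)`_j) t 1.
Proof.
move=> t01; case: (ltnP j n.+1) => jn; last first.
  rewrite (_ : (fun u => _) = cst 0); first exact: derivable_cst.
  by apply/funext => u; rewrite nth_default// (leq_trans (size_hankel_dual _ _)).
rewrite (_ : (fun u => _) = fun u => invmx (hankel_mx (m u) n) i (Ordinal jn)).
  apply: derivable_invmx => [|k l].
    by apply: filterS (near_itv01 t01) => u; exact: D_neq0.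
  rewrite (_ : (fun u => _) = m^~ (k + l)%N); last by apply/funext => u; rewrite mxE.
  exact: (@ex_derive _ _ _ _ _ _ _ (dm _ t01)).
by apply/funext => u; rewrite -(coef_hankel_dual (m u) i (Ordinal jn)).
Qed.

Let pd_of (p : R -> {poly R}) (t : R) : {poly R} :=
  \poly_(j < n.+1) 'D_1 (fun u => (p u)`_j) t.

Let dP t := pd_of P t.
Let dq t := pd_of q t.

Lemma is_derive_coef_q (t : R) j : 0 < t < 1 ->
  is_derive t 1 (fun u => (q u)`_j) (dq t)`_j.
Proof.
move=> t01; rewrite coef_poly; case: ltnP => jn.
  by apply: derivableP; exact: derivable_dual.
rewrite (_ : (fun u => _) = cst 0); first exact: is_derive_cst.
by apply/funext => u; rewrite nth_default// (leq_trans (size_hankel_dual _ _)).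
Qed.

Lemma is_derive_coef_P (t : R) j : 0 < t < 1 ->
  is_derive t 1 (fun u => (P u)`_j) (dP t)`_j.
Proof.
move=> t01; rewrite coef_poly; case: ltnP => jn.
  apply: derivableP; rewrite (_ : (fun u => _) = fun u => (j == n.+1)%:R -
    \sum_(i < n.+1) m u (n.+1 + i)%N * (hankel_dual (m u) i)`_j).
    apply: derivableB; first exact: derivable_cst.
    pose d (i : 'I_n.+1) := 'D_1 (fun u => m u (n.+1 + i)%N * (hankel_dual (m u) i)`_j) t.
    have hd (i : 'I_n.+1) : is_derive t 1 (fun u => m u (n.+1 + i)%N * (hankel_dual (m u) i)`_j) (d i).
      apply: derivableP; apply: derivableM; last exact: derivable_dual.
      exact: (@ex_derive _ _ _ _ _ _ _ (dm _ t01)).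
    exact: (@ex_derive _ _ _ _ _ _ _ (is_derive_bigsum _ hd)).
  apply/funext => u; rewrite coefB coefXn coef_sum; congr (_ - _).
  by apply: eq_bigr => i _; rewrite coefZ.
have [->|jn1] := eqVneq j n.+1.
  rewrite (_ : (fun u => _) = cst 1); first exact: is_derive_cst.
  apply/funext => u; have := hankel_P_monic (m u) n.
  by rewrite monicE lead_coefE size_hankel_P => /eqP.
rewrite (_ : (fun u => _) = cst 0); first exact: is_derive_cst.
apply/funext => u; rewrite nth_default// size_hankel_P.
by rewrite ltn_neqAle eq_sym jn1.
Qed.

(** Differentiates [L (p * X^l)], constant for the orthogonal polynomials. *)
Lemma flow_mul (p : R -> {poly R}) (pd : {poly R}) (w : nat -> R) (t : R) :
  0 < t < 1 -> (forall u, (size (p u) <= n.+2)%N) -> (size pd <= n.+2)%N ->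
  (forall j, is_derive t 1 (fun u => (p u)`_j) pd`_j) ->
  (forall (u : R) l, (l < n.+1)%N -> 0 < u < 1 -> momfun (m u) (p u * 'X^l) = w l) ->
  forall f : {poly R}, (size f <= n.+1)%N ->
   momfun (m t) (pd * f) + (c / t * momfun (m t) (p t * f)
     + t ^- 2 * momfun (es t) (p t * f)) = 0.
Proof.
move=> t01 sp spd hp hw f sf.
rewrite !(momfun_mul_expand _ _ sf) !mulr_sumr -!big_split/= big1// => l _.
rewrite [X in _ + (X + _)]mulrCA [X in _ + (_ + X)]mulrCA -!mulrDr.
have hl : is_derive t 1 (fun u => momfun (m u) (p u * 'X^l)) 0.
  apply: (@near_eq_is_derive R R R (cst (w l))).
  by apply: filterS (near_itv01 t01) => u u01; rewrite hw.
have := is_derive_momfun sp spd hp (e := fun u i => m u (i + l)%N)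
  (fun j => dm (j + l) t01).
have -> : (fun u => momfun (fun i => m u (i + l)%N) (p u)) =
   (fun u => momfun (m u) (p u * 'X^l)).
  by apply/funext => u; rewrite momfun_mulXn.
move=> hd; have := @derive_val _ _ _ _ _ _ _ hl.
rewrite (@derive_val _ _ _ _ _ _ _ hd) => e0.
rewrite [X in _ * X](_ : _ = 0) ?mulr0// -[RHS]e0 !momfun_mulXn; congr (_ + _).
rewrite /momfun !mulr_sumr -big_split/=; apply: eq_bigr => i _; ring.
Qed.

Lemma flow_dP (t : R) : 0 < t < 1 ->
  dP t = - (t ^- 2 * momfun (es t) (P t)) *: cdk (P t) (q t) t^-1.
Proof.
move=> t01; have D0 := D_neq0 t01.
apply: (flow_P (hankel_P_monic _ _) (size_hankel_P _ _) (size_hankel_dual _ _)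
  (hankel_P_mul D0) (hankel_q_mul D0) (polar_es t01) (gam := c / t)).
  exact: size_poly.
apply: (flow_mul (p := P) (w := fun=> 0) t01) => //.
- by move=> u; rewrite size_hankel_P.
- by rewrite (leq_trans (size_poly _ _)).
- by move=> j; exact: is_derive_coef_P.
by move=> u l ln u01; rewrite (hankel_P_mul (D_neq0 u01)) ?size_polyXn.
Qed.

Lemma flow_dq (t : R) : 0 < t < 1 ->
  dq t = - (c / t) *: q t - (t ^- 2 * momfun (es t) (q t)) *: cdk (P t) (q t) t^-1.
Proof.
move=> t01; have D0 := D_neq0 t01.
apply: (flow_q (hankel_P_monic _ _) (size_hankel_P _ _) (size_hankel_dual _ _)
  (hankel_P_mul D0) (hankel_q_mul D0) (polar_es t01) (gam := c / t)).
  exact: size_poly.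
apply: (flow_mul (p := q) (w := fun l => (n == l)%:R) t01) => //.
- by move=> u; rewrite (leq_trans (size_hankel_dual _ _)).
- by rewrite (leq_trans (size_poly _ _)).
- by move=> j; exact: is_derive_coef_q.
move=> u l ln u01; rewrite (hankel_q_mul (D_neq0 u01)) ?size_polyXn//.
by rewrite coefXn.
Qed.

(** The Jacobi formula gives the trace of the inverse Hankel matrix times its
    derivative, that is [L] and [Es] applied to the diagonal of the reproducing
    kernel. *)
Lemma is_derive_hankel_det (t : R) : 0 < t < 1 ->
  is_derive t 1 Dn (Dn t * (c / t * n.+1%:R
     + t ^- 2 * momfun (es t) (cdk (P t) (q t) t^-1))).
Proof.
move=> t01; have D0 := D_neq0 t01.
pose md j := c / t * m t j + es t j / t ^+ 2.
have hd : is_derive t 1 Dn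
    (\sum_(i < n.+1) \sum_(j < n.+1) md (i + j)%N * cofactor (hankel_mx (m t) n) i j).
  have := @is_derive_det _ _ (fun u => hankel_mx (m u) n)
    (\matrix_(i < n.+1, j < n.+1) md (i + j)%N) t.
  under eq_bigr do under eq_bigr do rewrite mxE.
  apply => i j; rewrite mxE (_ : (fun u => _) = m^~ (i + j)%N); first exact: dm.
  by apply/funext => u; rewrite mxE.
apply: (is_derive_eq hd).
rewrite -(trace_polar (hankel_P_monic _ _) (size_hankel_P _ _) (size_hankel_dual _ _)
  (hankel_P_mul D0) (hankel_q_mul D0) (polar_es t01) (k := @hankel_dual _ (m t) n)); last 2 first.
- by move=> i; exact: size_hankel_dual.
- by move=> i f sf; rewrite /= hankel_dual_mul.
have -> : n.+1%:R = \sum_(i < n.+1) momfun (m t) (hankel_dual (m t) i * 'X^i).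
  under eq_bigr do rewrite hankel_dualXn// eqxx.
  by rewrite sumr_const card_ord.
rewrite exchange_big/= !mulr_sumr -big_split/= mulr_sumr; apply: eq_bigr => i _.
rewrite !momfun_mulXn !(momfun_wide _ (size_hankel_dual _ _)) !mulr_sumr -big_split/=.
rewrite mulr_sumr; apply: eq_bigr => j _.
rewrite coef_hankel_dual /invmx unitmxE unitfE D0 !mxE /md addnC /Dn.
by field; rewrite -/(hankel_mx _ _) D0; case/andP: t01 => /lt0r_neq0.
Qed.


Let N : R := n.+1%:R.
Let P0 u := (P u).[0].
Let q0 u := (q u).[0].
Let P1 u := (P u).[1].
Let q1 u := (q u).[1].
Let Ps u := (P u).[u^-1].
Let qs u := (q u).[u^-1].
Let A0 u := momfun (em0 u) (P u).
Let B0 u := momfun (em0 u) (q u).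
Let A1 u := momfun (em1 u) (P u).
Let B1 u := momfun (em1 u) (q u).
Let As u := momfun (es u) (P u).
Let Bs u := momfun (es u) (q u).

Let wronskian (u : R) : 0 < u < 1 ->
  [/\ P0 u * B0 u - q0 u * A0 u = - a, P1 u * B1 u - q1 u * A1 u = - b
    & Ps u * Bs u - qs u * As u = - c].
Proof.
move=> u01; have D0 := D_neq0 u01.
have H := polar_wronskian (hankel_P_monic (m u) n) (size_hankel_P (m u) n)
  (size_hankel_dual _ _) (hankel_P_mul D0) (hankel_q_mul D0).
split; [exact: H (polar_em0 u)|exact: H (polar_em1 u)|exact: H (polar_es u01)].
Qed.

Let sums (u : R) : 0 < u < 1 ->
  [/\ P0 u * A0 u + P1 u * A1 u + Ps u * As u = 0,
      q0 u * B0 u + q1 u * B1 u + qs u * Bs u = 0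
    & q0 u * A0 u + q1 u * A1 u + qs u * As u = - N].
Proof.
move=> u01; have D0 := D_neq0 u01; split.
- exact: (pearson_PP (size_hankel_P _ _) (hankel_P_mul D0)
    (polar_em0 u) (polar_em1 u) (polar_es u01) (pearson_em u01)).
- exact: (pearson_qq (size_hankel_dual _ _) (hankel_q_mul D0)
    (polar_em0 u) (polar_em1 u) (polar_es u01) (pearson_em u01)).
- exact: (pearson_Pq (hankel_P_monic _ _) (size_hankel_P _ _)
    (size_hankel_dual _ _) (hankel_P_mul D0) (hankel_q_mul D0)
    (polar_em0 u) (polar_em1 u) (polar_es u01) (pearson_em u01)).
Qed.

Let horner_cdk_inv (u x : R) : 0 < u < 1 -> 1 - u * x != 0 ->
  (cdk (P u) (q u) u^-1).[x] =
  u * ((Ps u * (q u).[x] - qs u * (P u).[x]) / (1 - u * x)).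
Proof.
move=> u01 ux; have [u0 _] := neq_itv01 u01.
have ux' : u^-1 != x by apply: contraNneq ux => <-; rewrite divff// subrr.
by rewrite (horner_cdk _ _ ux') /Ps /qs; field; rewrite u0 ux.
Qed.

Let momfun_cdk (e : nat -> R) (u x th : R) : 0 < u < 1 -> 1 - u * x != 0 ->
  polar (momfun (m u)) (momfun e) x th ->
  momfun e (cdk (P u) (q u) u^-1) =
  u * (Ps u * momfun e (q u) - qs u * momfun e (P u) + th) / (1 - u * x).
Proof.
move=> u01 ux hp; have [u0 _] := neq_itv01 u01; have D0 := D_neq0 u01.
have := polar_cdk (hankel_P_monic (m u) n) (size_hankel_P (m u) n)
  (size_hankel_dual _ _) (hankel_P_mul D0) (hankel_q_mul D0) hp u^-1.
rewrite -/(P u) -/(q u) /= => h.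
have xu : u^-1 - x != 0 by rewrite -(mulrI_eq0 _ (mulfI u0)) mulrBr divff.
apply/eqP; rewrite -(inj_eq (mulfI xu)) h; apply/eqP; rewrite /Ps /qs.
by field; rewrite u0 ux.
Qed.

Let sP u : (size (P u) <= n.+2)%N. Proof. by rewrite size_hankel_P. Qed.
Let sq u : (size (q u) <= n.+1)%N. Proof. exact: size_hankel_dual. Qed.
Let sdP u : (size (dP u) <= n.+1)%N. Proof. exact: size_poly. Qed.
Let sdq u : (size (dq u) <= n.+1)%N. Proof. exact: size_poly. Qed.

Let dhP (t x : R) : 0 < t < 1 -> 1 - t * x != 0 ->
  is_derive t 1 (fun u => (P u).[x])
    (((P t).[x] * qs t - (q t).[x] * Ps t) * As t / (t * (1 - t * x))).
Proof.
move=> t01 tx; have [t0 _] := neq_itv01 t01.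
apply: (is_derive_eq (is_derive_horner x sP (leqW (sdP t))
  (fun j => is_derive_coef_P j t01))).
rewrite flow_dP// hornerZ horner_cdk_inv// /As.
by field; rewrite t0 tx.
Qed.

Let dhq (t x : R) : 0 < t < 1 -> 1 - t * x != 0 ->
  is_derive t 1 (fun u => (q u).[x])
    (((P t).[x] * qs t - (q t).[x] * Ps t) * Bs t / (t * (1 - t * x))
     - c / t * (q t).[x]).
Proof.
move=> t01 tx; have [t0 _] := neq_itv01 t01.
apply: (is_derive_eq (is_derive_horner x sq (sdq t)
  (fun j => is_derive_coef_q j t01))).
rewrite flow_dq// hornerD hornerN !hornerZ horner_cdk_inv// /Bs.
by field; rewrite t0 tx.
Qed.

(** Evolution of the [u] vector at a fixed pole [x]. *)
Section PolarDerivative.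
Variables (e : R -> nat -> R) (x th t : R).
Hypotheses (t01 : 0 < t < 1) (tx : 1 - t * x != 0).
Hypothesis hpol : polar (momfun (m t)) (momfun (e t)) x th.
Hypothesis de : forall j, is_derive t 1 (e^~ j)
  (c / t * e t j - (c * e t j - th * es t j) / (t * (1 - t * x))).

Let momfun_de (p : {poly R}) :
  momfun (fun j => c / t * e t j - (c * e t j - th * es t j) / (t * (1 - t * x))) p
  = c / t * momfun (e t) p
    - (c * momfun (e t) p - th * momfun (es t) p) / (t * (1 - t * x)).
Proof.
rewrite /momfun !mulr_sumr -sumrB mulr_suml -sumrB; apply: eq_bigr => i _.
by ring.
Qed.

Lemma polar_derivative : is_derive t 1 (fun u => momfun (e u) (P u))
    (- (As t * (Ps t * momfun (e t) (q t) - qs t * momfun (e t) (P t))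
        + c * momfun (e t) (P t)) / (t * (1 - t * x))
     + c / t * momfun (e t) (P t)) /\
  is_derive t 1 (fun u => momfun (e u) (q u))
    (- (Bs t * (Ps t * momfun (e t) (q t) - qs t * momfun (e t) (P t))
      + c * momfun (e t) (q t)) / (t * (1 - t * x))).
Proof.
have [t0 _] := neq_itv01 t01; split.
  apply: (is_derive_eq (is_derive_momfun sP (leqW (sdP t))
    (fun j => is_derive_coef_P j t01) de)).
  rewrite momfun_de flow_dP// scalar_polyZ /= (momfun_cdk t01 tx hpol) /As.
  by field; rewrite t0 tx.
apply: (is_derive_eq (is_derive_momfun sq (sdq t)
  (fun j => is_derive_coef_q j t01) de)).
rewrite momfun_de flow_dq// scalar_polyB !scalar_polyZ /= (momfun_cdk t01 tx hpol) /Bs.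
by field; rewrite t0 tx.
Qed.

End PolarDerivative.

Let y0 u := (Ps u * B0 u - qs u * A0 u) * (P0 u * Bs u - q0 u * As u).
Let y1 u := (Ps u * B1 u - qs u * A1 u) * (P1 u * Bs u - q1 u * As u).
Let x u := (P0 u * B1 u - q0 u * A1 u) * (P1 u * B0 u - q1 u * A0 u).
Let T1 u := (P0 u * B1 u - q0 u * A1 u) * (P1 u * Bs u - q1 u * As u)
  * (Ps u * B0 u - qs u * A0 u).
Let T2 u := (P0 u * Bs u - q0 u * As u) * (Ps u * B1 u - qs u * A1 u)
  * (P1 u * B0 u - q1 u * A0 u).

Let d_y (t : R) : 0 < t < 1 ->
  is_derive t 1 y0 (- (T1 t - T2 t) / (t * (1 - t))) /\
  is_derive t 1 y1 ((T1 t - T2 t) / t).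
Proof.
move=> t01; have [t0 t1] := neq_itv01 t01.
have [W0 W1 Ws] := wronskian t01; have [S1 S2 S3] := sums t01.
have z0 : 1 - t * 0 != 0 by rewrite mulr0 subr0 oner_neq0.
have z1 : 1 - t * 1 != 0 by rewrite mulr1.
have dP0 := dhP t01 z0; have dq0 := dhq t01 z0.
have dP1 := dhP t01 z1; have dq1 := dhq t01 z1.
have [|dA0 dB0] := polar_derivative t01 z0 (polar_em0 t) (e := em0).
  move=> j; apply: (is_derive_eq (is_derive_em0 j t01)).
  by field; rewrite t0.
have [|dA1 dB1] := polar_derivative t01 z1 (polar_em1 t) (e := em1).
  by move=> j; rewrite mulr1; exact: is_derive_em1.
rewrite mulr0 subr0 mulr1 in dP0 dq0 dA0 dB0.
rewrite mulr1 in dP1 dq1 dA1 dB1.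
have dx := @is_derive_cross01 R c P0 q0 A0 B0 P1 q1 A1 B1 _ _ _ _ t t0 t1 dP0 dq0 dP1 dq1 dA0 dB0 dA1 dB1 Ws.
have dg0 := @is_derive_diag0 R c P0 q0 A0 B0 _ _ _ _ t t0 dq0 dA0 Ws.
have dg1 := @is_derive_diag1 R c P1 q1 A1 B1 _ _ _ _ t t0 t1 dq1 dA1 Ws.
have hc := residue_commutator W0 W1 Ws S1 S2 S3.
split.
- apply: (@near_eq_is_derive R R R (fun u => - a ^+ 2 - x u + a * (N + (a + b + c))
     - (2 * N + (a + b + c)) * (q0 u * A0 u))).
    apply: filterS (near_itv01 t01) => u u01.
    have [W0' W1' Ws'] := wronskian u01; have [S1' S2' S3'] := sums u01.
    by rewrite /y0 (residue_y0 W0' W1' Ws' S1' S2' S3').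
  apply: is_derive_eq; rewrite /GRing.scale/=.
  by rewrite /T1 /T2 hc; field; rewrite t0 t1.
- apply: (@near_eq_is_derive R R R (fun u => - b ^+ 2 - x u + b * (N + (a + b + c))
     - (2 * N + (a + b + c)) * (q1 u * A1 u))).
    apply: filterS (near_itv01 t01) => u u01.
    have [W0' W1' Ws'] := wronskian u01; have [S1' S2' S3'] := sums u01.
    by rewrite /y1 (residue_y1 W0' W1' Ws' S1' S2' S3').
  (* the off-diagonal entries of the three residues sum to zero *)
  have e : P1 t * A1 t * (qs t * Bs t) - q1 t * B1 t * (Ps t * As t)
      = - (P0 t * A0 t * (qs t * Bs t) - q0 t * B0 t * (Ps t * As t)).
    have -> : P1 t * A1 t = - (P0 t * A0 t + Ps t * As t).
      by apply/eqP; rewrite -addr_eq0 -[X in _ == X]S1; apply/eqP; ring.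
    have -> : q1 t * B1 t = - (q0 t * B0 t + qs t * Bs t).
      by apply/eqP; rewrite -addr_eq0 -[X in _ == X]S2; apply/eqP; ring.
    by ring.
  rewrite -/P1 -/q1 e in dg1.
  apply: is_derive_eq; rewrite /GRing.scale/=.
  by rewrite /T1 /T2 hc; field; rewrite t0 t1.
Qed.

(** The Hankel determinant as a tau function: everything the sigma-form needs,
    without reference to polynomials. *)
Theorem hankel_schlesinger : exists y0 y1 x T1 T2 : R -> R,
  forall t : R, 0 < t < 1 ->
  [/\ is_derive t 1 (fun u => ln (\det (hankel_mx (m u) n)))
        ((c * n.+1%:R + (c * a - y0 t) + (c * b - y1 t) / (1 - t)) / t),
      x t + y0 t + y1 t = (n.+1%:R ^+ 2 + (n.+1%:R + (a + b + c)) ^+ 2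
        - a ^+ 2 - b ^+ 2 - c ^+ 2) / 2,
      T1 t + T2 t = a * b * c - a * y1 t - b * y0 t - c * x t,
      T1 t * T2 t = x t * y0 t * y1 t &
      is_derive t 1 y0 (- (T1 t - T2 t) / (t * (1 - t))) /\
      is_derive t 1 y1 ((T1 t - T2 t) / t)].
Proof.
exists y0, y1, x, T1, T2 => t t01; have [t0 t1] := neq_itv01 t01.
have [W0 W1 Ws] := wronskian t01; have [S1 S2 S3] := sums t01.
have D0 := D_neq0 t01.
split; last exact: d_y.
- have := @is_derive1_comp R (@ln R) Dn t _ _ (is_derive1_ln (D_gt0 t01))
    (is_derive_hankel_det t01).
  move=> h; apply: (is_derive_eq h).
  rewrite (polar_cdk_self (hankel_P_monic _ _) (size_hankel_P _ _)
    (size_hankel_dual _ _) (hankel_P_mul D0) (hankel_q_mul D0)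
    (polar_em0 t) (polar_em1 t) (polar_es t01) (pearson_em t01)).
  + rewrite -/(P t) -/(q t) -/(Ps t) -/(qs t) /=.
    rewrite -/(A0 t) -/(B0 t) -/(A1 t) -/(B1 t) -/(As t) -/(Bs t).
    rewrite -/(P0 t) -/(q0 t) -/(P1 t) -/(q1 t) -/(y0 t) -/(y1 t) -/N /Dn.
    by field; rewrite t0 t1 D0.
  + by rewrite invr_eq0.
  + by apply: contraNneq t1 => h1; rewrite -[t]invrK h1 invr1 subrr.
- have := residue_trace W0 W1 Ws S1 S2 S3; rewrite -/(x t) -/(y0 t) -/(y1 t) => h.
  by apply: (mulfI (x := 2)); rewrite ?pnatr_eq0// h; field.
- exact: residue_det W0 W1 Ws.
- by rewrite /T1 /T2 /x /y0 /y1; ring.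
Qed.

End MomentSystem.

(** * Positivity of Hankel determinants *)

Section GramPositivity.
Context {R : realFieldType}.
Variable m : nat -> R.
Hypothesis m_pos : forall p : {poly R}, p != 0 -> 0 < momfun m (p * p).

(** The cofactors of the last row are the coefficients of a polynomial [p]
    orthogonal to lower degrees, with leading coefficient the smaller
    determinant; then [L (p * p)] is the product of the two determinants. *)
Lemma hankel_gt0 n : 0 < \det (\matrix_(i < n, j < n) m (i + j)%N).
Proof.
elim: n => [|n IH]; first by rewrite det_mx00.
set H := (X in \det X).
pose p : {poly R} := \poly_(j < n.+1) cofactor H ord_max (inord j).
have pE (j : 'I_n.+1) : p`_j = cofactor H ord_max j.
  by rewrite coef_poly ltn_ord inord_val.
have pn : 0 < p`_n.
  rewrite (pE ord_max) /cofactor addnn -signr_odd odd_double expr0 mul1r.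
  rewrite (_ : row' _ _ = \matrix_(i < n.+1.-1, j < n.+1.-1) m (i + j)%N)//.
  by apply/matrixP => i j; rewrite !mxE !lift_max.
have p0 : p != 0 by apply: contraTneq pn => ->; rewrite coef0 ltxx.
have sp : (size p <= n.+1)%N by exact: size_poly.
have := m_pos p0; rewrite (momfun_mul_expand _ _ sp) big_ord_recr/= big1 => [|i _].
  rewrite add0r pmulr_rgt0// momfun_mulXn (momfun_wide _ sp).
  rewrite (expand_det_row H ord_max); congr (0 < _); apply: eq_bigr => j _.
  by rewrite pE mxE mulrC [in RHS]addnC.
rewrite momfun_mulXn (momfun_wide _ sp).
have := congr1 (fun M : 'M[R]_n.+1 => M (widen_ord (leqnSn n) i) ord_max) (mul_mx_adj H).
rewrite !mxE (_ : (_ == _) = false); last first.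
  by apply/negP => /eqP/(congr1 val)/= /eqP; rewrite ltn_eqF.
move=> h; rewrite (_ : \sum_(_ < _) _ = 0) ?mulr0// -[RHS]h.
by apply: eq_bigr => j _; rewrite pE !mxE mulrC /= addnC.
Qed.

End GramPositivity.

(** * Improper integrals over the open unit interval *)

Section ImproperIntegral.
Context {R : realType}.
Implicit Types f F : R -> R.
Local Notation mu := (@lebesgue_measure R).
Local Notation I01 := (`]0%R, 1%R[%classic : set R).

(** Compact segments exhausting the open interval [0, 1], away from the
    endpoints, where the integrands may blow up. *)
Definition lpt (n : nat) : R := n.+2%:R^-1.
Definition rpt (n : nat) : R := 1 - n.+2%:R^-1.
Definition seg (n : nat) : set R := `[lpt n, rpt n]%classic.

Lemma lpt_gt0 n : 0 < lpt n. Proof. by rewrite invr_gt0. Qed.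
Lemma rpt_lt1 n : rpt n < 1. Proof. by rewrite /rpt gtrBl lpt_gt0. Qed.
Lemma lpt_le12 n : lpt n <= 2^-1.
Proof. by rewrite lef_pV2 ?posrE// ler_nat. Qed.

Lemma lpt_le_rpt n : lpt n <= rpt n.
Proof. by have := lpt_le12 n; rewrite /rpt -/(lpt n); lra. Qed.

Lemma lpt01 n : 0 < lpt n < 1.
Proof. by rewrite lpt_gt0 (le_lt_trans (lpt_le12 n))//; lra. Qed.

Lemma rpt01 n : 0 < rpt n < 1.
Proof. by rewrite rpt_lt1 (lt_le_trans (lpt_gt0 n))// lpt_le_rpt. Qed.

Lemma lpt_ni n p : (n <= p)%N -> lpt p <= lpt n.
Proof. by move=> np; rewrite lef_pV2 ?posrE// ler_nat !ltnS. Qed.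

Lemma cvg_lpt : lpt @ \oo --> (0 : R).
Proof. by have := @cvg_harmonic R; rewrite -cvg_shiftS. Qed.

Lemma seg_homo : {homo seg : n p / (n <= p)%N >-> (n <= p)%O}.
Proof.
move=> n p np; apply/subsetPset => x; rewrite /seg/= !in_itv/= => /andP[h1 h2].
have := lpt_ni np; rewrite /rpt -!/(lpt _) in h2 *; lra.
Qed.

Lemma seg_sub n : seg n `<=` I01.
Proof.
move=> x; rewrite /seg/= !in_itv/= => /andP[h1 h2].
by rewrite (lt_le_trans (lpt_gt0 n))//= (le_lt_trans h2)// rpt_lt1.
Qed.

Lemma bigcup_seg : \bigcup_n seg n = I01.
Proof.
apply/seteqP; split => [x [n _]|x]; first exact: seg_sub.
rewrite /= in_itv/= => /andP[x0 x1].
pose e := Num.min x (1 - x).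
have e0 : 0 < e by rewrite lt_min x0 subr_gt0.
have [n _ /(_ n (leqnn n))] := near_infty_natSinv_lt (PosNum e0).
rewrite /= lt_min => /andP[h1 h2]; exists n => //.
have h : lpt n <= (n.+1%:R : R)^-1 by rewrite lef_pV2 ?posrE// ler_nat.
rewrite /seg/= in_itv/= /rpt -/(lpt n).
have h3 := le_lt_trans h h1; have h4 := le_lt_trans h h2.
by apply/andP; split; lra.
Qed.

Lemma measurable_seg n : measurable (seg n). Proof. exact: measurable_itv. Qed.

Lemma integral_seg_FTC f F n :
  (forall x : R, 0 < x < 1 -> derivable f x 1) ->
  (forall x : R, 0 < x < 1 -> is_derive x 1 F (f x)) ->
  (\int[mu]_(x in seg n) (f x)%:E)%E = (F (rpt n) - F (lpt n))%:E.
Proof.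
move=> df dF.
have sub01 (x : R) : x \in `[lpt n, rpt n] -> 0 < x < 1.
  by move=> h; have := @seg_sub n x; rewrite /seg/= h in_itv => /(_ isT).
have := lpt_le_rpt n; rewrite le_eqVlt => /predU1P[e|lr].
  by rewrite /seg e set_itv1 integral_set1 subrr.
rewrite (continuous_FTC2 (f := f) (F := F) lr).
- by rewrite EFinB.
- by apply: derivable_within_continuous => x /sub01; exact: df.
- have cF (x : R) : 0 < x < 1 -> {for x, continuous F}.
    move=> /dF d; apply: differentiable_continuous; apply/derivable1_diffP.
    exact: (@ex_derive _ _ _ _ _ _ _ d).
  split.
  + move=> x xlr; apply: (@ex_derive _ _ _ _ _ _ _ (dF _ (sub01 _ _))).
    exact: subset_itv_oo_cc.
  + apply: cvg_at_right_filter; apply: cF; apply: sub01.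
    by rewrite in_itv/= lexx ltW.
  + apply: cvg_at_left_filter; apply: cF; apply: sub01.
    by rewrite in_itv/= lexx ltW.
- move=> x xlr; rewrite derive1E; apply: (@derive_val _ _ _ _ _ _ _ (dF _ (sub01 _ _))).
  exact: subset_itv_oo_cc.
Qed.

Lemma measurable_derivable01 f : (forall x : R, 0 < x < 1 -> derivable f x 1) ->
  measurable_fun I01 f.
Proof.
move=> df; apply: open_continuous_measurable_fun; first exact: interval_open.
move=> x; rewrite inE/= in_itv/= => /df h.
by apply: differentiable_continuous; apply/derivable1_diffP.
Qed.

(** For a nonnegative function the integrals over the segments increase to the
    integral, and a bounded primitive bounds them. *)
Lemma integrable_ge0_primitive f F (M : R) :
  (forall x : R, 0 < x < 1 -> derivable f x 1) ->
  (forall x : R, 0 < x < 1 -> 0 <= f x) ->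
  (forall x : R, 0 < x < 1 -> is_derive x 1 F (f x)) ->
  (forall x : R, 0 < x < 1 -> `|F x| <= M) ->
  mu.-integrable I01 (EFin \o f).
Proof.
move=> df f0 dF FM.
have mf := measurable_derivable01 df.
apply/integrableP; split; first exact/measurable_EFinP.
have -> : (\int[mu]_(x in I01) `|(EFin \o f) x|)%E = (\int[mu]_(x in I01) (f x)%:E)%E.
  apply: eq_integral => x; rewrite inE/= in_itv/= => /f0 h.
  by rewrite ger0_norm.
apply: (@le_lt_trans _ _ (M + M)%:E); last exact: ltry.
have hc : ((\int[mu]_(x in seg n) (EFin \o f) x)%E @[n --> \oo] -->
   (\int[mu]_(x in I01) (EFin \o f) x)%E).
  rewrite -bigcup_seg; apply: ge0_nondecreasing_set_cvg_integral => [||n|n x].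
  - exact: seg_homo.
  - exact: measurable_seg.
  - by apply: measurable_funS (@seg_sub n) _ => //; exact/measurable_EFinP.
  - by move=> /seg_sub/=; rewrite in_itv/= => /f0; rewrite lee_fin.
apply: cvge_le hc; apply: nearW => n.
have -> : (\int[mu]_(x in seg n) (EFin \o f) x)%E = (F (rpt n) - F (lpt n))%:E.
  exact: integral_seg_FTC.
rewrite lee_fin; have hs (x : R) : x \in `[lpt n, rpt n] -> `|F x| <= M.
  by move=> hx; apply: FM; have := @seg_sub n x hx; rewrite /= in_itv.
have h1 : `|F (rpt n)| <= M by apply: hs; rewrite in_itv/= lexx andbT lpt_le_rpt.
have h2 : `|F (lpt n)| <= M by apply: hs; rewrite in_itv/= lexx lpt_le_rpt.
by have /ler_normlP[? ?] := h1; have /ler_normlP[? ?] := h2; lra.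
Qed.

Lemma cvg_Rintegral_seg f : mu.-integrable I01 (EFin \o f) ->
  (fun n => \int[mu]_(x in seg n) f x) @ \oo --> \int[mu]_(x in I01) f x.
Proof.
move=> intf; apply: fine_cvg; rewrite fineK; last exact: integrable_fin_num.
rewrite (_ : (fun n => _) = fun n => (\int[mu]_(x in I01) ((EFin \o f) \_ (seg n)) x)%E).
  apply: (@dominated_cvg _ _ _ mu _ _ _ _ (fun x => `|(f x)%:E|)%E) => //.
  - move=> n; apply/(measurable_restrict _ _ _).1 => //.
      exact: measurable_seg.
    apply: (@measurable_funS _ _ _ _ I01) => //; last exact: (measurable_int mu).
  - move=> x Ix; have [n _ sx] : (\bigcup_n seg n) x by rewrite bigcup_seg.
    apply: cvg_near_cst; exists n => // p /= np.
    rewrite patchE ifT// inE.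
    by move/subsetPset : (seg_homo np); apply.
  - exact: integrable_abse.
  - move=> n x Ix; rewrite patchE; case: ifPn => // _.
    by rewrite (_ : point = 0%E)// abse0 abse_ge0.
apply/funext => n; rewrite -integral_mkcondr; congr (integral _ _ _).
apply/seteqP; split => [x sx|x [_ sx]] //; split => //; exact: (@seg_sub n).
Qed.

Lemma Rintegral_seg_FTC f F n :
  (forall x : R, 0 < x < 1 -> derivable f x 1) ->
  (forall x : R, 0 < x < 1 -> is_derive x 1 F (f x)) ->
  \int[mu]_(x in seg n) f x = F (rpt n) - F (lpt n).
Proof. by move=> df dF; rewrite /Rintegral (integral_seg_FTC n df dF). Qed.

Lemma Rintegral_FTC01 f F (A B : R) :
  mu.-integrable I01 (EFin \o f) ->
  (forall x : R, 0 < x < 1 -> derivable f x 1) ->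
  (forall x : R, 0 < x < 1 -> is_derive x 1 F (f x)) ->
  F \o lpt @ \oo --> A -> F \o rpt @ \oo --> B ->
  \int[mu]_(x in I01) f x = B - A.
Proof.
move=> intf df dF FA FB; have := cvg_Rintegral_seg intf.
rewrite (_ : (fun n => _) = (F \o rpt) \- (F \o lpt)); last first.
  by apply/funext => n; exact: Rintegral_seg_FTC.
move/cvg_lim => <-//; apply: cvg_lim => //; exact: cvgB.
Qed.

End ImproperIntegral.

(** * Moments of the deformed Jacobi weight *)

Section JacobiWeight.
Context {R : realType}.
Local Notation mu := (@lebesgue_measure R).
Local Notation I01 := (`]0%R, 1%R[%classic : set R).

Lemma powR_le_bound (e y g : R) : 0 < e -> e <= y <= 1 -> y `^ g <= e `^ (- `|g|).
Proof.
move=> e0 /andP[ey y1]; have y0 : 0 < y := lt_le_trans e0 ey.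
apply: (@le_trans _ _ (y `^ (- `|g|))).
  by apply: ger_powR; rewrite ?y0//; have := ler_norm (- g); rewrite normrN; lra.
rewrite !powRN lef_pV2 ?posrE ?powR_gt0//.
by apply: ge0_ler_powR; rewrite ?nnegrE ?normr_ge0// ltW.
Qed.

Lemma powR_le1 (y g : R) : 0 <= g -> 0 <= y <= 1 -> y `^ g <= 1.
Proof.
move=> g0 /andP[y0 y1]; have <- : 1 `^ g = 1 :> R by rewrite powR1.
by apply: ge0_ler_powR; rewrite ?nnegrE.
Qed.

Lemma is_derive_powR_affine (k x g : R) : 0 < 1 - k * x ->
  is_derive x 1 (fun y => (1 - k * y) `^ g) (- (g * k * (1 - k * x) `^ (g - 1))).
Proof.
move=> kx.
have h : is_derive x 1 (fun y : R => 1 - k * y) (- k).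
  by apply: is_derive_eq; rewrite /GRing.scale/=; ring.
apply: (is_derive_eq (@is_derive1_comp R (@powR R ^~ g) _ x _ _ (is_derive1_powR g kx) h)).
by ring.
Qed.

Lemma is_derive_powR_onem (x g : R) : x < 1 ->
  is_derive x 1 (fun y => (1 - y) `^ g) (- (g * (1 - x) `^ (g - 1))).
Proof.
move=> x1; have h : 0 < 1 - 1 * x by rewrite mul1r subr_gt0.
have := is_derive_powR_affine g h.
by under eq_fun do rewrite mul1r; rewrite mul1r mulr1.
Qed.

Lemma integrable_powR01 (a : R) : -1 < a ->
  mu.-integrable I01 (EFin \o (fun x => x `^ a)).
Proof.
move=> a1; have a0 : a + 1 != 0 by apply/lt0r_neq0; lra.
apply: (@integrable_ge0_primitive _ _ (fun x => (a + 1)^-1 * x `^ (a + 1)) `|(a + 1)^-1|).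
- move=> x /andP[x0 _]; exact: (@ex_derive _ _ _ _ _ _ _ (is_derive1_powR a x0)).
- by move=> x _; exact: powR_ge0.
- move=> x /andP[x0 _]; have h := is_derive1_powR (a + 1) x0.
  by apply: is_derive_eq; rewrite /GRing.scale/= addrK mulrA mulVf// mul1r.
- move=> x /andP[x0 x1]; rewrite normrM ler_piMr// ger0_norm ?powR_ge0//.
  by rewrite powR_le1 ?(ltW x0) ?(ltW x1)//; lra.
Qed.

Lemma integrable_powR01_onem (b : R) : -1 < b ->
  mu.-integrable I01 (EFin \o (fun x => (1 - x) `^ b)).
Proof.
move=> b1; have b0 : b + 1 != 0 by apply/lt0r_neq0; lra.
apply: (@integrable_ge0_primitive _ _ (fun x => - (b + 1)^-1 * (1 - x) `^ (b + 1)) `|(b + 1)^-1|).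
- move=> x /andP[_ x1]; exact: (@ex_derive _ _ _ _ _ _ _ (is_derive_powR_onem b x1)).
- by move=> x _; exact: powR_ge0.
- move=> x /andP[_ x1]; have h := is_derive_powR_onem (b + 1) x1.
  by apply: is_derive_eq; rewrite /GRing.scale/= addrK; field.
- move=> x /andP[x0 x1]; rewrite normrM normrN ler_piMr// ger0_norm ?powR_ge0//.
  by rewrite powR_le1 ?subr_ge0 ?(ltW x1)//; lra.
Qed.

Lemma measurable_w2 (a b c u : R) (j : nat) :
  measurable_fun [set: R] (fun x => x ^+ j * w2 a b c u x).
Proof.
apply: measurable_funM; first exact: measurable_funX.
apply: measurable_funM; first apply: measurable_funM.
- exact: measurable_powR.
- by apply: measurableT_comp (measurable_powR _) _; exact: measurable_funB.
- apply: measurableT_comp (measurable_powR _) _.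
  by apply: measurable_funB => //; exact: measurable_funM.
Qed.

Lemma w2_ge0 (a b c u x : R) : 0 <= w2 a b c u x.
Proof. by rewrite /w2 !mulr_ge0 ?powR_ge0. Qed.

Lemma affine_bounds (u x : R) : 0 <= u < 1 -> 0 < x < 1 -> 1 - u <= 1 - u * x <= 1.
Proof. by move=> /andP[u0 u1] /andP[x0 x1]; apply/andP; split; nra. Qed.

(** A dominating function independent of the parameter: on each half of the
    interval the factor that is singular at the far endpoint is bounded. *)
Lemma w2_le (a b c u v x : R) (j : nat) : 0 <= u <= v -> v < 1 -> 0 < x < 1 ->
  x ^+ j * w2 a b c u x <= (1 - v) `^ (- `|c|) * 2^-1 `^ (- (`|a| + `|b|))
    * (x `^ a + (1 - x) `^ b).
Proof.
move=> /andP[u0 uv] v1 /andP[x0 x1].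
have ub : 1 - v <= 1 - u * x <= 1 by apply/andP; split; nra.
have cb : (1 - u * x) `^ c <= (1 - v) `^ (- `|c|).
  by apply: powR_le_bound => //; lra.
have ha : 2^-1 `^ (- `|a|) <= 2^-1 `^ (- (`|a| + `|b|)) :> R.
  by apply: ger_powR; [lra|have := normr_ge0 b; lra].
have hb : 2^-1 `^ (- `|b|) <= 2^-1 `^ (- (`|a| + `|b|)) :> R.
  by apply: ger_powR; [lra|have := normr_ge0 a; lra].
set K := 2^-1 `^ (- (`|a| + `|b|)) in ha hb *.
have K0 : 0 <= K by exact: powR_ge0.
have pa : 0 <= x `^ a by exact: powR_ge0.
have pb : 0 <= (1 - x) `^ b by exact: powR_ge0.
have ab : x `^ a * (1 - x) `^ b <= K * (x `^ a + (1 - x) `^ b).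
  case: (lerP x 2^-1) => hx.
    have : (1 - x) `^ b <= K by apply: le_trans hb; apply: powR_le_bound; lra.
    by move=> h; nra.
  have : x `^ a <= K by apply: le_trans ha; apply: powR_le_bound; lra.
  by move=> h; nra.
have xj : x ^+ j <= 1 by rewrite exprn_ile1 ?ltW.
have xj0 : 0 <= x ^+ j by rewrite exprn_ge0 ?ltW.
rewrite /w2; apply: (@le_trans _ _ (x `^ a * (1 - x) `^ b * (1 - u * x) `^ c)).
  by rewrite ler_piMl// !mulr_ge0 ?powR_ge0.
rewrite [leRHS](_ : _ = K * (x `^ a + (1 - x) `^ b) * (1 - v) `^ (- `|c|)).
  by apply: ler_pM => //; rewrite ?mulr_ge0 ?powR_ge0.
by ring.
Qed.

Lemma integrable_w2 (a b c u : R) (j : nat) : -1 < a -> -1 < b -> 0 <= u < 1 ->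
  mu.-integrable I01 (EFin \o (fun x => x ^+ j * w2 a b c u x)).
Proof.
move=> a1 b1 /andP[u0 u1].
pose K := (1 - u) `^ (- `|c|) * 2^-1 `^ (- (`|a| + `|b|)).
have hG : mu.-integrable I01 (EFin \o (fun x => K * (x `^ a + (1 - x) `^ b))).
  rewrite (_ : EFin \o _ = (fun x => K%:E * ((x `^ a)%:E + ((1 - x) `^ b)%:E))%E).
    apply: integrableZl => //; apply: integrableD => //.
      exact: integrable_powR01.
    exact: integrable_powR01_onem.
  by apply/funext => x.
apply: le_integrable hG => //.
- apply/measurable_EFinP; apply: measurable_funS (measurable_w2 a b c u j) => //.
- move=> x; rewrite /= in_itv/= => x01; rewrite lee_fin.
  have xj : 0 <= x ^+ j by rewrite exprn_ge0//; case/andP: x01 => /ltW.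
  rewrite !ger0_norm; first by apply: w2_le => //; rewrite u0 lexx.
    by rewrite !mulr_ge0 ?addr_ge0 ?powR_ge0.
  by rewrite mulr_ge0 ?w2_ge0.
Qed.

(** The open interval avoids the endpoints, where the weight may be singular. *)
Definition moment (a b c u : R) (j : nat) : R :=
  \int[mu]_(x in I01) (x ^+ j * w2 a b c u x).

Lemma Rintegral_cc_oo (p q : R) (f : R -> R) : measurable_fun [set: R] f ->
  \int[mu]_(x in `[p, q]) f x = \int[mu]_(x in `]p, q[) f x.
Proof.
move=> mf; rewrite /Rintegral integral_itv_bndoo//.
by apply/measurable_EFinP; exact: measurable_funS mf.
Qed.

Lemma hankel_w2E (a b c u : R) (n : nat) :
  hankel_det `[0, 1] (w2 a b c u) n
  = \det (\matrix_(i < n, j < n) moment a b c u (i + j)).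
Proof.
congr (\det _); apply/matrixP => i j; rewrite !mxE.
by apply: Rintegral_cc_oo; exact: measurable_w2.
Qed.

End JacobiWeight.

Section JacobiMoments.
Context {R : realType}.
Local Notation mu := (@lebesgue_measure R).
Local Notation I01 := (`]0%R, 1%R[%classic : set R).
Variables (a b : R).
Hypotheses (a1 : -1 < a) (b1 : -1 < b).

Let ap1 : 0 < a + 1. Proof. by rewrite -ltrBlDr sub0r. Qed.
Let bp1 : 0 < b + 1. Proof. by rewrite -ltrBlDr sub0r. Qed.

Let mI : measurable I01. Proof. exact: measurable_itv. Qed.

Lemma powR_pred (y g : R) : 0 < y -> y * y `^ (g - 1) = y `^ g.
Proof.
move=> y0; rewrite -{1}[y]powRr1 ?ltW// -powRD; first by congr (_ `^ _); ring.
by rewrite (gt_eqF y0) implybT.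
Qed.

Lemma w2_contiguous (c u x : R) : 0 < 1 - u * x ->
  w2 a b c u x = (1 - u * x) * w2 a b (c - 1) u x.
Proof. by move=> h; rewrite /w2 mulrCA powR_pred. Qed.

Let affine_gt0 (u x : R) : 0 <= u < 1 -> I01 x -> 0 < 1 - u * x.
Proof. by rewrite /= in_itv/= => /andP[? ?] /andP[? ?]; nra. Qed.

Let int_lin (c1 c2 : R) (f g : R -> R) :
  mu.-integrable I01 (EFin \o f) -> mu.-integrable I01 (EFin \o g) ->
  mu.-integrable I01 (EFin \o (fun x => c1 * f x + c2 * g x)) /\
  \int[mu]_(x in I01) (c1 * f x + c2 * g x)
  = c1 * \int[mu]_(x in I01) f x + c2 * \int[mu]_(x in I01) g x.
Proof.
move=> intf intg.
have i1 : mu.-integrable I01 (EFin \o (fun x => c1 * f x)).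
  by rewrite (_ : EFin \o _ = (fun x => c1%:E * (EFin \o f) x)%E)//; exact: integrableZl.
have i2 : mu.-integrable I01 (EFin \o (fun x => c2 * g x)).
  by rewrite (_ : EFin \o _ = (fun x => c2%:E * (EFin \o g) x)%E)//; exact: integrableZl.
split; last by rewrite RintegralD// !RintegralZl.
rewrite (_ : EFin \o _ = (fun x => (EFin \o (fun x => (c1 * f x)%R)) x
  + (EFin \o (fun x => (c2 * g x)%R)) x)%E)//.
exact: integrableD.
Qed.

Lemma moment_contiguous (c u : R) j : 0 <= u < 1 ->
  moment a b c u j = moment a b (c - 1) u j - u * moment a b (c - 1) u j.+1.
Proof.
move=> u01.
have [_] := int_lin 1 (- u) (integrable_w2 (c - 1) j a1 b1 u01)
  (integrable_w2 (c - 1) j.+1 a1 b1 u01).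
rewrite mul1r mulNr => <-; apply: eq_Rintegral => x; rewrite inE => Ix.
by rewrite (w2_contiguous _ (affine_gt0 u01 Ix)) exprSr; ring.
Qed.

(** Differentiation under the integral sign on [0, v] with [t < v < 1], dominated
    by the bound of [w2_le]. *)
Lemma is_derive_moment (c t : R) j : 0 < t < 1 ->
  is_derive t 1 (fun u => moment a b c u j) (- c * moment a b (c - 1) t j.+1).
Proof.
move=> /andP[t0 t1]; pose v := (1 + t) / 2.
have tv : t < v by rewrite /v; lra.
have v1 : v < 1 by rewrite /v; lra.
have It : `]0, v[%classic t by rewrite /= in_itv/= t0.
pose f u x := x ^+ j * w2 a b c u x.
have df u x : `]0, v[%classic u -> I01 x ->
    is_derive u 1 (f^~ x) (- c * (x ^+ j.+1 * w2 a b (c - 1) u x)).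
  rewrite /= in_itv/= => /andP[u0 uv] Ix.
  have ux : 0 < 1 - x * u by rewrite mulrC affine_gt0// ltW//=; lra.
  have h := is_derive_powR_affine c ux.
  rewrite /f /w2 (_ : (fun u : R => _) = fun u => x ^+ j * x `^ a * (1 - x) `^ b * (1 - x * u) `^ c).
    by apply: is_derive_eq; rewrite /GRing.scale/= exprSr [u * x]mulrC; ring.
  by apply/funext => y; rewrite [y * x]mulrC; ring.
(* the derivative of the weight in [u] lowers [c] and brings a factor [x] *)
have p1 u x : `]0, v[%classic u -> I01 x ->
    partial1of2 f u x = - c * (x ^+ j.+1 * w2 a b (c - 1) u x).
  by move=> Iu Ix; rewrite partial1of2E; exact: (@derive_val _ _ _ _ _ _ _ (df u x Iu Ix)).
pose K := (1 - v) `^ (- `|c - 1|) * 2^-1 `^ (- (`|a| + `|b|)).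
pose G x := `|c| * (K * (x `^ a + (1 - x) `^ b)).
have G0 x : 0 <= G x by rewrite /G !mulr_ge0 ?addr_ge0 ?powR_ge0.
have intG : mu.-integrable I01 (EFin \o G).
  have [h _] := int_lin (`|c| * K) (`|c| * K) (integrable_powR01 a1) (integrable_powR01_onem b1).
  by rewrite (_ : G = fun x => `|c| * K * x `^ a + `|c| * K * (1 - x) `^ b)//;
    apply/funext => x; rewrite /G; ring.
have GU u x : `]0, v[%classic u -> I01 x -> `|partial1of2 f u x| <= G x.
  move=> Iu Ix; rewrite p1// normrM normrN ler_wpM2l//.
  have x0 : 0 < x by move: Ix; rewrite /= in_itv/= => /andP[].
  rewrite ger0_norm; last by rewrite mulr_ge0 ?w2_ge0// exprn_ge0// ltW.
  have x01 : 0 < x < 1 by move: Ix; rewrite /= in_itv.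
  apply: w2_le => //.
  by move: Iu; rewrite /= in_itv/= => /andP[/ltW-> /ltW].
have intf u : `]0, v[%classic u -> mu.-integrable I01 (EFin \o f u).
  rewrite /= in_itv/= => /andP[u0 uv]; apply: integrable_w2 => //.
  by rewrite ltW//= (lt_trans uv).
have df1 u x : `]0, v[%classic u -> I01 x -> derivable (f^~ x) u 1.
  by move=> Iu Ix; exact: (@ex_derive _ _ _ _ _ _ _ (df u x Iu Ix)).
split.
  exact: (@derivable_under_integral _ _ _ mu f I01 mI t 0 v It intf df1 G G0 intG GU).
rewrite -derive1E.
rewrite (@differentiation_under_integral _ _ _ mu f I01 mI t 0 v It intf df1 G G0 intG GU).
have t01 : 0 <= t < 1 by rewrite ltW.
rewrite -RintegralZl//; last exact: integrable_w2.
by apply: eq_Rintegral => x; rewrite inE => Ix; rewrite p1.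
Qed.

Lemma derivable_w2 (p q c u x : R) (j : nat) : 0 <= u < 1 -> 0 < x < 1 ->
  derivable (fun y : R => y ^+ j * w2 p q c u y) x 1.
Proof.
move=> u01 /andP[x0 x1].
have ux : 0 < 1 - u * x by apply: affine_gt0 => //; rewrite /= in_itv/= x0.
have h1 := is_derive1_powR p x0; have h2 := is_derive_powR_onem q x1.
have h3 := is_derive_powR_affine c ux.
have d1 := @ex_derive _ _ _ _ _ _ _ h1.
have d2 := @ex_derive _ _ _ _ _ _ _ h2.
have d3 := @ex_derive _ _ _ _ _ _ _ h3.
exact: (derivableM (@exprn_derivable _ j x 1) (derivableM (derivableM d1 d2) d3)).
Qed.

(** The integral of the derivative of [x^(j+1) w2 a (b+1) c], which vanishes at
    both ends because [a + 1] and [b + 1] are positive. *)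
Lemma moment_pearson (c u : R) j : 0 <= u < 1 ->
  (j.+1%:R + a) * (moment a b c u j - moment a b c u j.+1)
  - (b + 1) * moment a b c u j.+1
  - c * u * (moment a b (c - 1) u j.+1 - moment a b (c - 1) u j.+2) = 0.
Proof.
move=> u01; have [u0 u1] := andP u01.
pose F x := x ^+ j.+1 * w2 a (b + 1) c u x.
pose g i x := x ^+ i * w2 a b c u x.
pose h i x := x ^+ i * w2 a b (c - 1) u x.
pose f x := 1 * ((j.+1%:R + a) * g j x + (- (j.+1%:R + a + b + 1)) * g j.+1 x)
   + 1 * (- (c * u) * h j.+1 x + (c * u) * h j.+2 x).
have ig i : mu.-integrable I01 (EFin \o g i) by exact: integrable_w2.
have ih i : mu.-integrable I01 (EFin \o h i) by exact: integrable_w2.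
have [i1 e1] := int_lin (j.+1%:R + a) (- (j.+1%:R + a + b + 1)) (ig j) (ig j.+1).
have [i2 e2] := int_lin (- (c * u)) (c * u) (ih j.+1) (ih j.+2).
have [intf ef] := int_lin 1 1 i1 i2.
rewrite e1 e2 in ef.
have df (x : R) : 0 < x < 1 -> derivable f x 1.
  move=> x01; rewrite /f.
  have dg i : derivable (g i) x 1 by exact: derivable_w2.
  have dh i : derivable (h i) x 1 by exact: derivable_w2.
  have dl (c1 c2 : R) (p q : R -> R) : derivable p x 1 -> derivable q x 1 ->
      derivable (fun y : R => c1 * p y + c2 * q y) x 1.
    move=> dp dq; exact: (derivableD (derivableM (derivable_cst c1 x 1) dp)
      (derivableM (derivable_cst c2 x 1) dq)).
  exact: (dl 1 1 _ _ (dl _ _ _ _ (dg j) (dg j.+1)) (dl _ _ _ _ (dh j.+1) (dh j.+2))).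
have dF (x : R) : 0 < x < 1 -> is_derive x 1 F (f x).
  move=> /andP[x0 x1].
  have ux : 0 < 1 - u * x by apply: affine_gt0 => //; rewrite /= in_itv/= x0.
  have h1 := is_derive1_powR a x0; have h2 := is_derive_powR_onem (b + 1) x1.
  have h3 := is_derive_powR_affine c ux.
  have h0 : is_derive x 1 (fun y : R => y ^+ j.+1) (j.+1%:R * x ^+ j).
    by split; [exact: exprn_derivable|rewrite exp_derive /GRing.scale/= mulr1].
  rewrite /F /w2; apply: is_derive_eq; rewrite /GRing.scale/= /f /g /h /w2.
  have ea : x `^ a = x * x `^ (a - 1) by rewrite powR_pred.
  have eb : (1 - x) `^ (b + 1) = (1 - x) * (1 - x) `^ b.
    by rewrite -[in RHS](addrK 1 b) powR_pred ?subr_gt0.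
  have ec : (1 - u * x) `^ c = (1 - u * x) * (1 - u * x) `^ (c - 1) by rewrite powR_pred.
  rewrite addrK ea eb ec !exprS -!natr1.
  ring.
pose C := (1 - u) `^ (- `|c|).
have FC x : 0 < x < 1 -> 0 <= F x /\ F x <= C * x `^ (a + 1) /\ F x <= C * (1 - x) `^ (b + 1).
  move=> x01; have /andP[x0 x1] := x01.
  have hc : (1 - u * x) `^ c <= C.
    apply: (@powR_le_bound _ (1 - u)); first by rewrite subr_gt0.
    exact: (affine_bounds u01 x01).
  have xj : x ^+ j <= 1 by rewrite exprn_ile1 ?ltW.
  have xj0 : 0 <= x ^+ j by rewrite exprn_ge0 ?ltW.
  have xa : x `^ (a + 1) = x * x `^ a by rewrite -[in RHS](addrK 1 a) powR_pred.
  have p0 : 0 <= x `^ (a + 1) <= 1 by rewrite powR_ge0 powR_le1 ?(ltW x0) ?(ltW x1) ?(ltW ap1).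
  have q0 : 0 <= (1 - x) `^ (b + 1) <= 1.
    rewrite powR_ge0 powR_le1 ?(ltW bp1)// subr_ge0 (ltW x1)/=.
    by rewrite gerBl ltW.
  have r0 : 0 <= (1 - u * x) `^ c by exact: powR_ge0.
  have FE : F x = x ^+ j * ((1 - u * x) `^ c * (x `^ (a + 1) * (1 - x) `^ (b + 1))).
    by rewrite /F /w2 xa exprS; ring.
  have [/andP[p0' p1] /andP[q0' q1]] := (p0, q0).
  have C0 : 0 <= C by exact: powR_ge0.
  have FC' : F x <= C * (x `^ (a + 1) * (1 - x) `^ (b + 1)).
    rewrite FE; apply: (@le_trans _ _ ((1 - u * x) `^ c * (x `^ (a + 1) * (1 - x) `^ (b + 1)))).
      by rewrite ler_piMl// !mulr_ge0.
    by rewrite ler_wpM2r// mulr_ge0.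
  split; first by rewrite FE !mulr_ge0.
  split; apply: (le_trans FC'); apply: ler_wpM2l => //.
    by rewrite ler_piMr.
  by rewrite ler_piMl.
(* both bounds of [F] tend to zero at the ends of the segments *)
have cl (g0 : R) : 0 < g0 -> (fun n => C * (@lpt R n) `^ g0) @ \oo --> (0 : R).
  move=> gp; rewrite -(mulr0 C); apply: cvgMr.
  apply: (@cvg_comp _ _ _ (@lpt R) (fun y => y `^ g0) _ _ _ _ (powR_cvg0 gp)).
  move=> A hA; have [N _ hN] := @cvg_lpt R _ hA.
  by exists N => // n /hN; apply; exact: lpt_gt0.
have l01 := @lpt01 R; have r01 := @rpt01 R.
have FA : F \o @lpt R @ \oo --> (0 : R).
  apply: (@squeeze_cvgr _ _ _ R (cst 0) (fun n => C * (@lpt R n) `^ (a + 1))).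
  - by apply: nearW => n /=; have [h1 [h2 _]] := FC _ (l01 n); rewrite h1 h2.
  - exact: cvg_cst.
  - exact: cl ap1.
have FB : F \o @rpt R @ \oo --> (0 : R).
  apply: (@squeeze_cvgr _ _ _ R (cst 0) (fun n => C * (@lpt R n) `^ (b + 1))).
  - apply: nearW => n /=; have [h1 [_ h2]] := FC _ (r01 n); rewrite h1/=.
    by apply: le_trans h2 _; rewrite /rpt -/(@lpt R n) opprB addrC subrK.
  - exact: cvg_cst.
  - exact: cl bp1.
have := Rintegral_FTC01 intf df dF FA FB; rewrite ef subrr => e0.
by rewrite -[RHS]e0 /moment /g /h; ring.
Qed.

End JacobiMoments.

Section MomentPositivity.
Context {R : realType}.
Local Notation mu := (@lebesgue_measure R).
Local Notation I01 := (`]0%R, 1%R[%classic : set R).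

Lemma root_set_negligible (p : {poly R}) : p != 0 ->
  mu [set x | p.[x] = 0] = 0%E.
Proof.
move=> p0; apply: countable_lebesgue_measure0; apply: finite_set_countable.
apply: contrapT => /(infinite_set_fset (size p))[B Bsub Bsz].
have allB : all (root p) (finmap.enum_fset B).
  by apply/allP => x xB; apply/eqP; exact: Bsub.
by have := max_poly_roots p0 allB (finmap.fset_uniq B); rewrite ltnNge Bsz.
Qed.

Variables (a b c u : R).
Hypotheses (a1 : -1 < a) (b1 : -1 < b) (u01 : 0 <= u < 1).

Lemma momfun_moment (p : {poly R}) :
  mu.-integrable I01 (EFin \o (fun x => p.[x] * w2 a b c u x)) /\
  momfun (moment a b c u) p = \int[mu]_(x in I01) (p.[x] * w2 a b c u x).
Proof.
pose w := w2 a b c u.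
pose S k x := (\sum_(i < k) p`_i * x ^+ i) * w x.
have H k : mu.-integrable I01 (EFin \o S k) /\
    \sum_(i < k) p`_i * moment a b c u i = \int[mu]_(x in I01) S k x.
  elim: k => [|k [IH1 IH2]].
    have -> : S 0 = cst 0 by apply/funext => x; rewrite /S big_ord0 mul0r.
    by rewrite big_ord0 Rintegral_cst// mul0r; split => //; exact: integrable0.
  have ig := integrable_w2 c k a1 b1 u01.
  have ik : mu.-integrable I01 (EFin \o (fun x => p`_k * (x ^+ k * w x))).
    rewrite (_ : EFin \o _ =
      (fun x => (p`_k)%:E * (EFin \o (fun x => (x ^+ k * w x)%R)) x)%E)//.
    exact: integrableZl.
  have -> : S k.+1 = fun x => S k x + p`_k * (x ^+ k * w x).
    by apply/funext => x; rewrite /S big_ord_recr/= mulrDl mulrA.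
  split.
    rewrite (_ : EFin \o _ = (fun x => (EFin \o S k) x +
      (EFin \o (fun x => (p`_k * (x ^+ k * w x))%R)) x)%E)//.
    exact: integrableD.
  by rewrite big_ord_recr/= RintegralD// IH2 RintegralZl.
have [h1 h2] := H (size p).
have e : S (size p) = (fun x => p.[x] * w2 a b c u x).
  by apply/funext => x; rewrite horner_coef.
by rewrite /momfun h2 -e.
Qed.

(** If the integral of [p^2 w] vanished, [p] would vanish almost everywhere on
    the interval, while its roots form a null set. *)
Lemma moment_pos (p : {poly R}) : p != 0 -> 0 < momfun (moment a b c u) (p * p).
Proof.
move=> p0; have [intp ->] := momfun_moment (p * p).
have f0 x : 0 <= (p * p).[x] * w2 a b c u x.
  by rewrite mulr_ge0 ?w2_ge0// hornerM -expr2 sqr_ge0.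
rewrite lt_neqAle Rintegral_ge0 ?andbT//; apply/negP => /eqP/esym e0.
have i0 : (\int[mu]_(x in I01) `|((p * p).[x] * w2 a b c u x)%:E|)%E = 0%E.
  under eq_integral do rewrite gee0_abs ?lee_fin//.
  by rewrite -[LHS]fineK ?[fine _]e0//; exact: integrable_fin_num.
have mf : measurable_fun I01 (fun x => ((p * p).[x] * w2 a b c u x)%:E).
  exact: (measurable_int mu).
have /(ae_eq_integral_abs mu (measurable_itv _) mf) [N [mN N0 sub]] := i0.
have : I01 `<=` N `|` [set x | p.[x] = 0].
  move=> x Ix; case: (eqVneq p.[x] 0) => [h|px]; [by right|left].
  apply: sub => /= h; have := h Ix => -[]; rewrite /w2 hornerM.
  move: Ix; rewrite /= in_itv/= => /andP[x0 x1].
  have ux : 0 < 1 - u * x.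
    case/andP: u01 => u0 u1; rewrite subr_gt0 (le_lt_trans _ x1)//.
    by rewrite ler_piMl// ltW.
  apply/eqP; rewrite !mulf_neq0// gt_eqF// powR_gt0// subr_gt0//.
move=> sub2.
have mroot : measurable [set x | p.[x] = 0].
  rewrite (_ : [set x | _] = (fun x => p.[x]) @^-1` [set 0])//.
  rewrite -[X in measurable X]setTI.
  by apply: (continuous_measurable_fun (@continuous_horner R p)) => //; exact: measurable_set1.
have : (mu I01 <= mu (N `|` [set x | p.[x] = 0%R]))%E.
  apply: le_measure; rewrite ?inE; [exact: measurable_itv|exact: measurableU|exact: sub2].
rewrite lebesgue_measure_itv/= lte01 oppr0 adde0 => h.
have := le_trans h (measureU2 mu mN mroot).
rewrite [X in (_ <= X + _)%E]N0 add0e [X in (_ <= X)%E](root_set_negligible p0).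
by rewrite lee_fin ler10.
Qed.

End MomentPositivity.

(** * The sigma-form of Painleve VI *)

(** The moments [es] of the polar functional at [1/u] are
    [- c u int x^j x^a (1-x)^b (1-u x)^(c-1)]. *)
Section PainleveVI.
Context {R : realType}.
Variables (a b c : R).
Hypotheses (a1 : -1 < a) (b1 : -1 < b).

Let es (u : R) j := - c * u * moment a b (c - 1) u j.

Let u01W (u : R) : 0 < u < 1 -> 0 <= u < 1.
Proof. by move=> /andP[/ltW-> ->]. Qed.

Let dm (u : R) j : 0 < u < 1 -> is_derive u 1 (fun v => moment a b c v j)
  (c / u * moment a b c u j + es u j / u ^+ 2).
Proof.
move=> u01; apply: (is_derive_eq (is_derive_moment a1 b1 c j u01)).
rewrite (moment_contiguous a1 b1 c j (u01W u01)) /es.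
by field; rewrite (neq_itv01 u01).
Qed.

Let esS (u : R) j : 0 < u < 1 -> es u j.+1 = es u j / u + c * moment a b c u j.
Proof.
move=> u01; rewrite (moment_contiguous a1 b1 c j (u01W u01)) /es.
by field; rewrite (neq_itv01 u01).
Qed.

Let pearson_m (u : R) j : 0 < u < 1 ->
  (j.+1%:R + a) * (moment a b c u j - moment a b c u j.+1)
  - (b + 1) * moment a b c u j.+1 + es u j.+1 - es u j.+2 = 0.
Proof.
by move=> u01; rewrite -[RHS](moment_pearson a1 b1 c j (u01W u01)) /es; ring.
Qed.

(** The derivative involves the exponent [c - 2]; integration by parts at the
    exponent [c - 1] brings it back. *)
Let des0 (u : R) : 0 < u < 1 ->
  is_derive u 1 (es^~ 0)
    (((a - (a + b + c) / u) * es u 0 - (1 + a + b + c) * c * moment a b c u 0) / (1 - u)).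
Proof.
move=> u01; have [u0 u1] := neq_itv01 u01; have uW := u01W u01.
have dmu := is_derive_moment a1 b1 (c - 1) 0 u01.
rewrite /es; apply: is_derive_eq; rewrite /GRing.scale/=.
rewrite (moment_contiguous a1 b1 c 0 uW).
have hp := moment_pearson a1 b1 (c - 1) 0 uW.
have h1 := moment_contiguous a1 b1 (c - 1) 1 uW.
set mu0 := moment a b (c - 1) u 0 in hp *.
set mu1 := moment a b (c - 1) u 1 in hp h1 *.
set n1 := moment a b (c - 1 - 1) u 1 in hp h1 *.
set n2 := moment a b (c - 1 - 1) u 2 in hp h1 *.
(* elimination of the moment [n2] between the two relations *)
have hn : (c - 1) * n1 = (- (1 + a) * mu0 + (1 + a + b + c) * mu1) / (1 - u).
  apply/eqP; rewrite -subr_eq0 -(inj_eq (mulfI u1)) mulr0.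
  rewrite -hp; apply/eqP.
  rewrite h1; field.
  by [].
transitivity (c * u * ((c - 1) * n1) - c * mu0); first by ring.
by rewrite hn; field; rewrite u0 u1.
Qed.

Lemma moment_hankel_gt0 (u : R) n : 0 < u < 1 ->
  0 < \det (\matrix_(i < n, j < n) moment a b c u (i + j)).
Proof. by move=> u01; apply: hankel_gt0; apply: moment_pos => //; exact: u01W. Qed.

Let log_hankelE n : log_hankel `[0, 1] (w2 a b c) n =
  fun u => ln (\det (\matrix_(i < n, j < n) moment a b c u (i + j))).
Proof. by apply/funext => u; rewrite /log_hankel hankel_w2E. Qed.

Let log_hankel0 : log_hankel `[0, 1] (w2 a b c) 0 = cst 0.
Proof. by rewrite log_hankelE; apply/funext => u; rewrite det_mx00 ln1. Qed.

(** At order zero the determinant is 1, and the residues are constant, with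
    diagonal entries 0 and minus the exponent. *)
Lemma hankel_painleve (n : nat) : exists y0 y1 x T1 T2 : R -> R,
  forall t : R, 0 < t < 1 ->
  [/\ is_derive t 1 (log_hankel `[0, 1] (w2 a b c) n)
        ((c * n%:R + (c * a - y0 t) + (c * b - y1 t) / (1 - t)) / t),
      x t + y0 t + y1 t = (n%:R ^+ 2 + (n%:R + (a + b + c)) ^+ 2
        - a ^+ 2 - b ^+ 2 - c ^+ 2) / 2,
      T1 t + T2 t = a * b * c - a * y1 t - b * y0 t - c * x t,
      T1 t * T2 t = x t * y0 t * y1 t &
      is_derive t 1 y0 (- (T1 t - T2 t) / (t * (1 - t))) /\
      is_derive t 1 y1 ((T1 t - T2 t) / t)].
Proof.
case: n => [|n].
  exists (cst (c * a)), (cst (c * b)), (cst (a * b)), (cst (- (a * b * c))), (cst (- (a * b * c))).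
  move=> t t01; split=> /=; try by field.
    by rewrite log_hankel0; apply: is_derive_eq; rewrite mulr0 !subrr mul0r !addr0 mul0r.
  by rewrite subrr oppr0 !mul0r; split; exact: is_derive_cst.
have := hankel_schlesinger dm esS pearson_m des0
  (fun u u01 => moment_hankel_gt0 n.+1 u01).
by rewrite log_hankelE.
Qed.

Theorem sigma_painleve (n : nat) (t : R) : 0 < t < 1 ->
  log_hankel_derivable `[0, 1] (w2 a b c) n t /\
  JMO_sigma_PVI (1 / 2 * (c - a)) (1 / 2 * (c + a)) (1 / 2 * (2 * n%:R + a + c))
    (1 / 2 * (2 * n%:R + a + 2 * b + c)) (fun s : R => sigma s n a b c) t.
Proof.
move=> t01; have [y0 [y1 [x [T1 [T2 H]]]]] := hankel_painleve n.
have [dl hx hs hp _] := H t t01; have [t0 t1] := neq_itv01 t01.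
split.
  split; first by rewrite hankel_w2E moment_hankel_gt0.
  exact: (@ex_derive _ _ _ _ _ _ _ dl).
pose sg (s : R) := sigma s n a b c.
pose d1 := - n%:R * c - 1 / 4 * (a + c) ^+ 2.
pose d0 := - (n%:R / 2) * (n%:R + a + b) + c / 4 * (2 * n%:R + a + b + c) - a * b / 4.
pose sx (s : R) := (s - 1) * (n%:R * c) + (1 - s) * (y0 s - c * a) + (y1 s - c * b)
  + d1 * s + d0.
have sgE s : 0 < s < 1 -> sg s = sx s.
  move=> s01; have [ds _ _ _ _] := H s s01; have [s0 s1] := neq_itv01 s01.
  rewrite /sg /sigma /hankel_H derive1E (@derive_val _ _ _ _ _ _ _ ds) /sx -/d1 -/d0.
  by field; rewrite s0 s1.
have dsg (s : R) : 0 < s < 1 -> is_derive s 1 sg (- y0 s - (a - c) ^+ 2 / 4).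
  move=> s01; have [_ _ _ _ [dy0 dy1]] := H s s01; have [s0 s1] := neq_itv01 s01.
  apply: (@near_eq_is_derive R R R sx).
    by apply: filterS (near_itv01 s01) => u u01; rewrite sgE.
  rewrite /sx; apply: is_derive_eq; rewrite /GRing.scale/= /d1.
  by field; rewrite s0 s1.
have sg1 (s : R) : 0 < s < 1 -> sg^`()%classic s = - y0 s - (a - c) ^+ 2 / 4.
  by move=> s01; rewrite derive1E; exact: (@derive_val _ _ _ _ _ _ _ (dsg s s01)).
have dsg1 : is_derive t 1 sg^`()%classic ((T1 t - T2 t) / (t * (1 - t))).
  have [_ _ _ _ [dy0 _]] := H t t01.
  apply: (@near_eq_is_derive R R R (fun s => - y0 s - (a - c) ^+ 2 / 4)).
    by apply: filterS (near_itv01 t01) => u u01; rewrite sg1.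
  apply: is_derive_eq; rewrite /GRing.scale/=.
  by field; rewrite t0 t1.
have sg2 : t * (t - 1) * sg^`(2)%classic t = T2 t - T1 t.
  rewrite [sg^`(2)%classic t](_ : _ = (T1 t - T2 t) / (t * (1 - t))).
    by field; rewrite t0 t1.
  by rewrite -(@derive_val _ _ _ _ _ _ _ dsg1) -derive1E.
split.
- exact: (@ex_derive _ _ _ _ _ _ _ (dsg t t01)).
- exact: (@ex_derive _ _ _ _ _ _ _ dsg1).
- apply: (gram_sigma_form (t := t) hx hs hp _ (sg1 t t01)).
    by rewrite -/(sg t) sgE.
  by right.
Qed.

End PainleveVI.

(** * Reflection and quadratic substitution *)

Section ImproperSubstitution.
Context {R : realType}.
Local Notation mu := (@lebesgue_measure R).
Local Notation I01 := (`]0%R, 1%R[%classic : set R).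
Local Notation J01 := (`](-1)%R, 0%R[%classic : set R).

Let in01 n (x : R) : x \in `[lpt n, rpt n] -> 0 < x < 1.
Proof. by move=> h; have := @seg_sub R n x h; rewrite /= in_itv. Qed.

Let ge0_cvg (D : set R) (S : nat -> set R) (f : R -> R) :
  {homo S : n p / (n <= p)%N >-> (n <= p)%O} -> (forall n, measurable (S n)) ->
  \bigcup_n S n = D -> measurable_fun [set: R] f -> (forall x, D x -> 0 <= f x) ->
  ((\int[mu]_(x in S n) (f x)%:E)%E @[n --> \oo] --> (\int[mu]_(x in D) (f x)%:E)%E).
Proof.
move=> hS mS <- mf f0; apply: ge0_nondecreasing_set_cvg_integral => //.
- by move=> n; apply/measurable_EFinP; exact: measurable_funS mf.
- by move=> n x Sx; rewrite lee_fin; apply: f0; exists n.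
Qed.

(** The change of variables holds on compact segments; both sides are limits
    along an exhaustion, [G] being nonnegative.  The same scheme gives the
    quadratic substitution. *)
Lemma ge0_integral_reflect (G : R -> R) : measurable_fun [set: R] G ->
  (forall x : R, -1 < x < 0 -> 0 <= G x) ->
  (forall x : R, -1 < x < 0 -> derivable G x 1) ->
  (\int[mu]_(x in J01) (G x)%:E = \int[mu]_(x in I01) (G (- x))%:E)%E.
Proof.
move=> mG G0 dG.
pose V n : set R := `[- rpt n, - lpt n]%classic.
have VE n x : V n x <-> seg n (- x).
  by rewrite /V /seg /= !in_itv/= lerNl lerNr andbC.
have c1 : ((\int[mu]_(x in V n) (G x)%:E)%E @[n --> \oo] -->
    (\int[mu]_(x in J01) (G x)%:E)%E).
  apply: ge0_cvg => //.
  - move=> n p np; apply/subsetPset => x /VE h; apply/VE.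
    by have /subsetPset := @seg_homo R n p np; apply.
  - by move=> n; exact: measurable_itv.
  - apply/seteqP; split => [x [n _ /VE/seg_sub]|x].
      by rewrite /= !in_itv/= => /andP[h1 h2]; rewrite ltrNl h2/= -oppr_gt0.
    rewrite /= in_itv/= => /andP[h1 h2].
    have : I01 (- x) by rewrite /= in_itv/= oppr_gt0 h2 ltrNl.
    by rewrite -bigcup_seg => -[n _ h]; exists n => //; apply/VE.
have c2 : ((\int[mu]_(x in seg n) (G (- x))%:E)%E @[n --> \oo] -->
    (\int[mu]_(x in I01) (G (- x))%:E)%E).
  apply: (ge0_cvg (f := fun x => G (- x))).
  - exact: seg_homo.
  - exact: measurable_seg.
  - exact: bigcup_seg.
  - exact: measurableT_comp.
  - by move=> x; rewrite /= in_itv/= => /andP[h1 h2]; apply: G0; rewrite oppr_lt0 h1 ltrN2 h2.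
suff e : (fun n => (\int[mu]_(x in V n) (G x)%:E)%E) =
    fun n => (\int[mu]_(x in seg n) (G (- x))%:E)%E.
  rewrite -(cvg_lim (@ereal_hausdorff R) c1) e.
  exact: (cvg_lim (@ereal_hausdorff R) c2).
apply/funext => n; rewrite /V integration_by_substitution_oppr//.
  exact: lpt_le_rpt.
apply: derivable_within_continuous => x; rewrite in_itv/= => /andP[h1 h2].
have /in01/andP[h3 h4] : - x \in `[lpt n, rpt n] by rewrite in_itv/= lerNr h2 lerNl.
by apply: dG; rewrite ltrNl h4/= -oppr_gt0.
Qed.

Lemma ge0_integral_square (G : R -> R) : measurable_fun [set: R] G ->
  (forall x : R, 0 < x < 1 -> 0 <= G x) ->
  (forall x : R, 0 < x < 1 -> derivable G x 1) ->
  (\int[mu]_(x in I01) (G x)%:E =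
   \int[mu]_(x in I01) (G (x ^+ 2) * (2 * x))%:E)%E.
Proof.
move=> mG G0 dG.
pose V n : set R := `[lpt n ^+ 2, rpt n ^+ 2]%classic.
have sq01 (x : R) : 0 < x < 1 -> 0 < x ^+ 2 < 1.
  by move=> /andP[x0 x1]; rewrite exprn_gt0// expr_lt1// ltW.
have c1 : ((\int[mu]_(x in V n) (G x)%:E)%E @[n --> \oo] -->
    (\int[mu]_(x in I01) (G x)%:E)%E).
  apply: ge0_cvg => //.
  - move=> n p np; apply/subsetPset => x; rewrite /V/= !in_itv/= => /andP[h1 h2].
    have h3 := @lpt_ni R n p np.
    have h4 : @rpt R n <= rpt p by rewrite /rpt lerD2l lerN2.
    have /andP[? _] := @lpt01 R p; have /andP[? _] := @rpt01 R n.
    have /andP[? _] := @lpt01 R n.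
    rewrite (le_trans _ h1) ?(le_trans h2)// lerXn2r// nnegrE ?ltW//.
    exact: lt_le_trans h4.
  - by move=> n; exact: measurable_itv.
  - apply/seteqP; split => [x [n _]|x].
      rewrite /V/= !in_itv/= => /andP[h1 h2].
      have /andP[h3 _] := sq01 _ (@lpt01 R n); have /andP[_ h4] := sq01 _ (@rpt01 R n).
      by rewrite (lt_le_trans h3 h1) (le_lt_trans h2 h4).
    rewrite /= in_itv/= => /andP[x0 x1].
    have : I01 (Num.sqrt x).
      by rewrite /= in_itv/= sqrtr_gt0 x0 -[X in _ < X]sqrtr1 ltr_sqrt.
    rewrite -bigcup_seg => -[n _]; rewrite /seg /= in_itv/= => /andP[h1 h2].
    exists n => //; rewrite /V /= in_itv/= -[x]sqr_sqrtr ?(ltW x0)//.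
    have /andP[h3 _] := @lpt01 R n; have /andP[h4 _] := @rpt01 R n.
    by rewrite !lerXn2r ?nnegrE ?sqrtr_ge0// ltW.
have c2 : ((\int[mu]_(x in seg n) (G (x ^+ 2) * (2 * x))%:E)%E @[n --> \oo] -->
    (\int[mu]_(x in I01) (G (x ^+ 2) * (2 * x))%:E)%E).
  apply: (ge0_cvg (f := fun x => G (x ^+ 2) * (2 * x))).
  - exact: seg_homo.
  - exact: measurable_seg.
  - exact: bigcup_seg.
  - apply: measurable_funM; last exact: measurable_funM.
    apply: measurableT_comp => //; exact: measurable_funX.
  - move=> x; rewrite /= in_itv/= => x01; have /andP[x0 _] := x01.
    by rewrite mulr_ge0 ?G0 ?sq01// mulr_ge0// ltW.
have dF : (fun x : R => x ^+ 2)^`()%classic = (fun x => 2 * x).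
  by apply/funext => x; rewrite exp_derive1 /GRing.scale/= expr1.
have cF : continuous (fun x : R => 2 * x).
  by move=> x; apply: cvgMr; exact: cvg_id.
suff e : (fun n => (\int[mu]_(x in V n) (G x)%:E)%E) =
    fun n => (\int[mu]_(x in seg n) (G (x ^+ 2) * (2 * x))%:E)%E.
  rewrite -(cvg_lim (@ereal_hausdorff R) c1) e.
  exact: (cvg_lim (@ereal_hausdorff R) c2).
apply/funext => n; have /andP[l0 _] := @lpt01 R n.
rewrite /V (@integration_by_substitution_increasing _ (fun x : R => x ^+ 2)).
- by rewrite dF.
- exact: lpt_le_rpt.
- move=> x y; rewrite !in_itv/= => /andP[hx _] /andP[hy _] xy.
  by rewrite ltrXn2r// ?nnegrE (le_trans _ hx, le_trans _ hy)// ltW.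
- by rewrite dF => x _; exact: cF.
- by rewrite dF; apply/cvg_ex; eexists; apply: cvg_at_right_filter; exact: cF.
- by rewrite dF; apply/cvg_ex; eexists; apply: cvg_at_left_filter; exact: cF.
- split.
  + by move=> x _; exact: exprn_derivable.
  + by apply: cvg_at_right_filter; exact: exprn_continuous.
  + by apply: cvg_at_left_filter; exact: exprn_continuous.
- apply: derivable_within_continuous => x; rewrite in_itv/= => /andP[h1 h2].
  have /andP[h3 _] := sq01 _ (@lpt01 R n); have /andP[_ h4] := sq01 _ (@rpt01 R n).
  by apply: dG; rewrite (lt_le_trans h3 h1) (le_lt_trans h2 h4).
Qed.

End ImproperSubstitution.

(** * The symmetric weight *)

Section SymmetricMoments.
Context {R : realType}.
Local Notation mu := (@lebesgue_measure R).
Local Notation I01 := (`]0%R, 1%R[%classic : set R).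
Local Notation J01 := (`](-1)%R, 0%R[%classic : set R).
Variables (alpha beta t : R).
Hypotheses (alpha1 : -1 < alpha) (t01 : 0 <= t < 1).

Local Notation g := (w_sym alpha beta t).

Let mI : measurable I01. Proof. exact: measurable_itv. Qed.
Let half1 : -1 < - (1 / 2) :> R. Proof. by lra. Qed.

Lemma measurable_w_sym : measurable_fun [set: R] g.
Proof.
apply: measurable_funM.
- apply: measurableT_comp (measurable_powR _) _.
  by apply: measurable_funB => //; exact: measurable_funX.
- apply: measurableT_comp (measurable_powR _) _.
  by apply: measurable_funB => //; apply: measurable_funM.
Qed.

Lemma w_sym_ge0 x : 0 <= g x.
Proof. by rewrite /w_sym mulr_ge0 ?powR_ge0. Qed.

Lemma w_sym_even x : g (- x) = g x.
Proof. by rewrite /w_sym sqrrN. Qed.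

Lemma derivable_w_sym (x : R) : -1 < x < 1 -> derivable g x 1.
Proof.
move=> /andP[x0 x1].
have x2 : x ^+ 2 < 1 by nra.
have h1 : 0 < 1 - x ^+ 2 by rewrite subr_gt0.
have h2 : 0 < 1 - t * x ^+ 2.
  case/andP: t01 => t0 t1; rewrite subr_gt0 (le_lt_trans _ t1)//.
  by rewrite ler_piMr// ltW.
have d0 : is_derive x 1 (fun y : R => y ^+ 2) (2 * x).
  by split; [exact: exprn_derivable|rewrite exp_derive /GRing.scale/= mulr1 expr1].
have d1 : is_derive x 1 (fun y : R => 1 - y ^+ 2) (- (2 * x)).
  by apply: is_derive_eq; rewrite add0r mul1r.
have d2 : is_derive x 1 (fun y : R => 1 - t * y ^+ 2) (- (t * (2 * x))).
  by apply: is_derive_eq; rewrite /GRing.scale/=; ring.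
have e1 := @is_derive1_comp R (@powR R ^~ alpha) _ x _ _ (is_derive1_powR alpha h1) d1.
have e2 := @is_derive1_comp R (@powR R ^~ beta) _ x _ _ (is_derive1_powR beta h2) d2.
exact: (derivableM (@ex_derive _ _ _ _ _ _ _ e1) (@ex_derive _ _ _ _ _ _ _ e2)).
Qed.

Let G i y := y ^+ i * w2 (- (1 / 2)) alpha beta t y.

Lemma w2_square i (x : R) : 0 < x -> G i (x ^+ 2) * (2 * x) = 2 * (x ^+ (2 * i) * g x).
Proof.
move=> x0; have h : (x ^+ 2) `^ (- (1 / 2)) = x^-1.
  rewrite powRN div1r powR12_sqrt ?sqr_ge0// sqrtr_sqr ger0_norm// ltW//.
rewrite /G /w2 /w_sym h -exprM.
by field; rewrite gt_eqF.
Qed.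

Lemma integral_w_sym_square i :
  (\int[mu]_(x in I01) (2 * (x ^+ (2 * i) * g x))%:E = \int[mu]_(x in I01) (G i x)%:E)%E.
Proof.
rewrite (ge0_integral_square (G := G i)).
- apply: eq_integral => x; rewrite inE/= in_itv/= => /andP[x0 _].
  by rewrite w2_square.
- exact: measurable_w2.
- by move=> x /andP[x0 _]; rewrite mulr_ge0 ?w2_ge0// exprn_ge0// ltW.
- by move=> x x01; exact: derivable_w2.
Qed.

Lemma measurable_xw_sym k : measurable_fun [set: R] (fun x => x ^+ k * g x).
Proof. by apply: measurable_funM; [exact: measurable_funX|exact: measurable_w_sym]. Qed.

Lemma integrable_w_sym01 k : mu.-integrable I01 (EFin \o (fun x => x ^+ k * g x)).
Proof.
have i0 : mu.-integrable I01 (EFin \o (fun x => 2 * (x ^+ (2 * 0) * g x))).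
  apply/integrableP; split.
    apply/measurable_EFinP; apply: measurable_funM => //.
    by apply: measurable_funS (measurable_xw_sym _).
  under eq_integral => x.
    rewrite inE/= in_itv/= => /andP[x0 _].
    rewrite ger0_norm; last by rewrite mulr_ge0// mulr_ge0 ?w_sym_ge0// exprn_ge0// ltW.
    over.
  rewrite integral_w_sym_square; have /integrableP[_] := integrable_w2 beta 0 half1 alpha1 t01.
  apply: le_lt_trans; apply: ge0_le_integral => //.
  - move=> x; rewrite /= in_itv/= => /andP[x0 _].
    by rewrite lee_fin mulr_ge0 ?w2_ge0.
  - by apply/measurable_EFinP; apply: measurable_funS (measurable_w2 _ _ _ _ _).
  - apply: measurableT_comp => //.
    by apply/measurable_EFinP; apply: measurable_funS (measurable_w2 _ _ _ _ _).
  - by move=> x _; rewrite lee_fin ler_norm.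
apply: le_integrable i0 => //.
- by apply/measurable_EFinP; apply: measurable_funS (measurable_xw_sym _).
- move=> x; rewrite /= in_itv/= => /andP[x0 x1]; rewrite lee_fin mul1r.
  have gx := w_sym_ge0 x.
  have xk0 : 0 <= x ^+ k by rewrite exprn_ge0// ltW.
  have xk : x ^+ k <= 1 by rewrite exprn_ile1 ?(ltW x0) ?(ltW x1).
  rewrite !ger0_norm ?(mulr_ge0 xk0 gx) ?(mulr_ge0 (ler0n _ 2) gx)//.
  by rewrite (le_trans (ler_wpM2r gx xk))// ler_wpM2r// ler1n.
Qed.

Let K k := \int[mu]_(x in I01) (x ^+ k * g x).

Lemma Rintegral_w_sym_even i : 2 * K (2 * i) = moment (- (1 / 2)) alpha beta t i.
Proof.
rewrite /K -RintegralZl//; last exact: integrable_w_sym01.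
by rewrite /Rintegral integral_w_sym_square.
Qed.

Lemma integral_w_sym_reflect k :
  (\int[mu]_(x in J01) ((- x) ^+ k * g x)%:E = \int[mu]_(x in I01) (x ^+ k * g x)%:E)%E.
Proof.
rewrite (ge0_integral_reflect (G := fun x => (- x) ^+ k * g x)).
- by apply: eq_integral => x _; rewrite opprK w_sym_even.
- apply: measurable_funM; last exact: measurable_w_sym.
  by apply: measurable_funX; exact: measurable_funN.
- move=> x /andP[_ x0]; rewrite mulr_ge0 ?w_sym_ge0// exprn_ge0//.
  by rewrite oppr_ge0 ltW.
- move=> x /andP[x0 x1].
  have dn : is_derive x 1 (fun y : R => - y) (-1) by apply: is_derive_eq.
  have dX : is_derive (- x) 1 (fun y : R => y ^+ k) (k%:R * (- x) ^+ k.-1).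
    by split; [exact: exprn_derivable|rewrite exp_derive /GRing.scale/= mulr1].
  have dc := @is_derive1_comp R (fun y : R => y ^+ k) _ x _ _ dX dn.
  apply: (derivableM (@ex_derive _ _ _ _ _ _ _ dc)); apply: derivable_w_sym.
  by rewrite x0 (lt_trans x1).
Qed.

Let JE : J01 `|` I01 = `]-1, 1[%classic `\ (0 : R).
Proof.
apply/seteqP; split => x /=; rewrite !in_itv/=.
  case=> /andP[h1 h2]; split.
  - by rewrite h1 (lt_trans h2).
  - by apply/eqP; rewrite lt_eqF.
  - by rewrite h2 (lt_trans _ h1).
  - by apply/eqP; rewrite gt_eqF.
move=> [/andP[h1 h2] /eqP x0]; case: (ltgtP x 0) x0 => // h _; [left|right].
  by rewrite h1.
by rewrite h2.
Qed.

Lemma hankel_moment_w_sym k :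
  \int[mu]_(x in `[-1, 1]) (x ^+ k * g x)
  = if odd k then 0 else moment (- (1 / 2)) alpha beta t k./2.
Proof.
pose f x := x ^+ k * g x.
have mf : measurable_fun [set: R] f by exact: measurable_xw_sym.
have mJ : measurable J01 by exact: measurable_itv.
have intJ : mu.-integrable J01 (EFin \o f).
  apply/integrableP; split.
    by apply/measurable_EFinP; exact: measurable_funS mf.
  have /integrableP[_] := integrable_w_sym01 k; apply: le_lt_trans.
  rewrite le_eqVlt; apply/orP; left; apply/eqP.
  transitivity (\int[mu]_(x in J01) ((- x) ^+ k * g x)%:E)%E.
    apply: eq_integral => x; rewrite inE/= in_itv/= => /andP[_ x0].
    congr (_%:E); rewrite /f normrM [`|g x|]ger0_norm ?w_sym_ge0// normrX.
    by rewrite ltr0_norm.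
  rewrite integral_w_sym_reflect.
  apply: eq_integral => x; rewrite inE/= in_itv/= => /andP[x0 _].
  by rewrite /= ger0_norm// mulr_ge0 ?w_sym_ge0// exprn_ge0// ltW.
have eJ : \int[mu]_(x in J01) f x = (-1) ^+ k * K k.
  transitivity (\int[mu]_(x in J01) ((-1) ^+ k * ((- x) ^+ k * g x))).
    apply: eq_Rintegral => x _; rewrite mulrA -exprMn mulN1r opprK//.
  have inn : mu.-integrable J01 (EFin \o (fun x => (- x) ^+ k * g x)).
    rewrite (_ : EFin \o _ = (fun x => ((-1) ^+ k)%:E * (EFin \o f) x)%E).
      exact: integrableZl.
    by apply/funext => x /=; rewrite -EFinM /f [in RHS]mulrA -exprMn mulN1r.
  by rewrite RintegralZl// /K /Rintegral integral_w_sym_reflect.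
have dis : [disjoint J01 & I01].
  apply/disj_setPS => x [/=]; rewrite !in_itv/= => /andP[_ h1] /andP[h2 _].
  by have := lt_trans h1 h2; rewrite ltxx.
have intU : mu.-integrable (J01 `|` I01) (EFin \o f).
  apply/integrableP; split.
    by apply/measurable_EFinP; exact: measurable_funS mf.
  rewrite ge0_integral_setU//; last first.
    apply: measurableT_comp => //.
    by apply/measurable_EFinP; exact: measurable_funS mf.
  apply: lte_add_pinfty; first by have /integrableP[] := intJ.
  by have /integrableP[] := integrable_w_sym01 k.
have -> : \int[mu]_(x in `[-1, 1]) f x = \int[mu]_(x in J01 `|` I01) f x.
  have mD : measurable (`]-1, 1[%classic `\ (0 : R)) by rewrite -JE; exact: measurableU.
  rewrite Rintegral_cc_oo// /Rintegral JE integral_setD1//.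
  by apply/measurable_EFinP; exact: measurable_funS mf.
rewrite Rintegral_setU// eJ -/(K k) -signr_odd.
case: ifPn => ok; first by rewrite expr1 mulN1r addNr.
have kE : (2 * k./2)%N = k by rewrite mul2n -[RHS]odd_double_half (negbTE ok).
by rewrite -(Rintegral_w_sym_even k./2) kE /= expr0; ring.
Qed.

End SymmetricMoments.

Section ParityDeterminant.
Context {F : comNzRingType}.

Lemma det_reindex n (A : 'M[F]_n) (f : 'I_n -> 'I_n) : injective f ->
  \det (\matrix_(i, j) A (f i) (f j)) = \det A.
Proof.
move=> fI; pose s := perm fI.
have -> : \matrix_(i, j) A (f i) (f j) = row_perm s (col_perm s A).
  by apply/matrixP => i j; rewrite !mxE !permE.
rewrite row_permE col_permE !det_mulmx !det_perm odd_permV mulrCA.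
by rewrite -signr_addb addbb mulr1.
Qed.

(** Listing the even indices before the odd ones makes the matrix block
    diagonal. *)
Lemma det_hankel_parity (h : nat -> F) (p q : nat) : (q <= p <= q.+1)%N ->
  (forall k, odd k -> h k = 0) ->
  \det (\matrix_(i < p + q, j < p + q) h (i + j)%N)
  = \det (\matrix_(i < p, j < p) h (2 * (i + j))%N)
    * \det (\matrix_(i < q, j < q) h (2 * (i + j).+1)%N).
Proof.
move=> /andP[qp pq] h0.
(* the index in position [i] once the even indices are listed first *)
pose g (i : nat) := if (i < p)%N then (2 * i)%N else (2 * (i - p)).+1.
have gb (i : 'I_(p + q)) : (g i < p + q)%N.
  by have := ltn_ord i; rewrite /g; case: ifPn; lia.
pose f (i : 'I_(p + q)) := Ordinal (gb i).
have fI : injective f.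
  move=> i j /(congr1 val) /=; rewrite /g => e; apply: val_inj; move: e => /=.
  by do 2 case: ifPn; lia.
rewrite -(det_reindex _ fI).
rewrite (_ : \matrix_(i, j) _ = block_mx
   (\matrix_(i < p, j < p) h (2 * (i + j))%N) 0 0
   (\matrix_(i < q, j < q) h (2 * (i + j).+1)%N)).
  by rewrite det_ublock.
apply/matrixP => i j; rewrite !mxE.
case: splitP => i' ei; rewrite !mxE; case: splitP => j' ej; rewrite !mxE /=.
all: rewrite /g ei ej ?ltn_ord.
- by congr (h _); lia.
- rewrite ltnNge leq_addr/=; apply: h0.
  by rewrite addKn addnS /= -mulnDr oddM.
- rewrite ltnNge leq_addr/=; apply: h0.
  by rewrite addKn addSn /= -mulnDr oddM.
- by rewrite !ltnNge !leq_addr/= !addKn; congr (h _); lia.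
Qed.

End ParityDeterminant.

Section SymmetricHankel.
Context {R : realType}.
Variables (alpha beta : R).
Hypothesis alpha1 : -1 < alpha.

Let mhalf1 : -1 < - (1 / 2) :> R. Proof. by lra. Qed.
Let half1 : -1 < 1 / 2 :> R. Proof. by lra. Qed.

(** Raising the exponent [a] by one shifts the moments, so the block of odd
    indices is the Hankel matrix for [a = 1/2]. *)
Lemma moment_shift (t : R) j :
  moment (- (1 / 2)) alpha beta t j.+1 = moment (1 / 2) alpha beta t j.
Proof.
apply: eq_Rintegral => x; rewrite inE/= in_itv/= => /andP[x0 _].
rewrite exprSr -mulrA /w2; congr (_ * _); rewrite !mulrA; congr (_ * _ * _).
by rewrite -(powR_pred (1 / 2) x0); congr (_ * _ `^ _); lra.
Qed.

Lemma hankel_w_sym_split (t : R) p q : 0 < t < 1 -> (q <= p <= q.+1)%N ->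
  hankel_det `[-1, 1] (w_sym alpha beta t) (p + q)
  = hankel_det `[0, 1] (w2 (- (1 / 2)) alpha beta t) p
    * hankel_det `[0, 1] (w2 (1 / 2) alpha beta t) q.
Proof.
move=> /andP[t0 t1] pq; have t01 : 0 <= t < 1 by rewrite ltW.
rewrite !hankel_w2E /hankel_det.
pose h k := if odd k then 0 else moment (- (1 / 2)) alpha beta t k./2.
have -> : \matrix_(i < p + q, j < p + q)
    \int[lebesgue_measure]_(x in `[-1, 1]) (x ^+ (i + j) * w_sym alpha beta t x)
    = \matrix_(i < p + q, j < p + q) h (i + j)%N.
  by apply/matrixP => i j; rewrite !mxE hankel_moment_w_sym.
rewrite det_hankel_parity//; last by move=> k ok; rewrite /h ok.
congr (_ * _); congr (\det _); apply/matrixP => i j.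
  by rewrite !mxE /h mul2n odd_double doubleK.
by rewrite !mxE /h mul2n odd_double doubleK moment_shift.
Qed.

Lemma log_hankel_w_sym (t : R) p q : 0 < t < 1 -> (q <= p <= q.+1)%N ->
  log_hankel_derivable `[-1, 1] (w_sym alpha beta) (p + q) t /\
  hankel_H `[-1, 1] (w_sym alpha beta) (p + q) t
  = hankel_H `[0, 1] (w2 (- (1 / 2)) alpha beta) p t
    + hankel_H `[0, 1] (w2 (1 / 2) alpha beta) q t.
Proof.
move=> t01 pq.
have [[D1 d1] _] := sigma_painleve beta mhalf1 alpha1 p t01.
have [[D2 d2] _] := sigma_painleve beta half1 alpha1 q t01.
pose f1 := log_hankel `[0, 1] (w2 (- (1 / 2)) alpha beta) p.
pose f2 := log_hankel `[0, 1] (w2 (1 / 2) alpha beta) q.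
have near_eq : \forall u \near t,
    (f1 \+ f2) u = log_hankel `[-1, 1] (w_sym alpha beta) (p + q) u.
  apply: filterS (near_itv01 t01) => u u01.
  have g1 : 0 < hankel_det `[0, 1] (w2 (- (1 / 2)) alpha beta u) p.
    by rewrite hankel_w2E; exact: moment_hankel_gt0.
  have g2 : 0 < hankel_det `[0, 1] (w2 (1 / 2) alpha beta u) q.
    by rewrite hankel_w2E; exact: moment_hankel_gt0.
  by rewrite /f1 /f2 /log_hankel (hankel_w_sym_split u01 pq) lnM ?posrE.
split.
  split; first by rewrite (hankel_w_sym_split t01 pq) mulr_gt0.
  exact: (near_eq_derivable near_eq (derivableD d1 d2)).
rewrite /hankel_H !derive1E.
have <- : 'D_1 (f1 \+ f2) t = 'D_1 (log_hankel `[-1, 1] (w_sym alpha beta) (p + q)) t.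
  exact: near_eq_derive.
by rewrite [X in _ * X](deriveD d1 d2) mulrDr.
Qed.

End SymmetricHankel.

Theorem theorem1p8 (R : realType) :
  (forall (alpha beta : R) (n : nat) (t : R),
     -1 < alpha -> 0 < t < 1 ->
     [/\ log_hankel_derivable `[-1, 1] (w_sym alpha beta) (2 * n)%N t,
         log_hankel_derivable `[-1, 1] (w_sym alpha beta) (2 * n + 1)%N t,
         hankel_H `[-1, 1] (w_sym alpha beta) (2 * n)%N t
         = sigma t n (- (1 / 2)) alpha beta + sigma t n (1 / 2) alpha beta
           + (beta ^+ 2 / 2 + 2 * n%:R * beta + 1 / 8) * t
           - beta / 2 * (2 * n%:R + alpha + beta)
           + n%:R * (n%:R + alpha) &
         hankel_H `[-1, 1] (w_sym alpha beta) (2 * n + 1)%N t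
         = sigma t (n + 1)%N (- (1 / 2)) alpha beta
           + sigma t n (1 / 2) alpha beta
           + (beta ^+ 2 / 2 + (2 * n%:R + 1) * beta + 1 / 8) * t
           - beta / 2 * (2 * n%:R + 1 + alpha + beta)
           + 1 / 4 * (2 * n%:R + 1) * (2 * n%:R + 1 + 2 * alpha)]) /\
  (forall (n : nat) (a b c t : R),
     -1 < a -> -1 < b -> 0 < t < 1 ->
     log_hankel_derivable `[0, 1] (w2 a b c) n t /\
     JMO_sigma_PVI
       (1 / 2 * (c - a))
       (1 / 2 * (c + a))
       (1 / 2 * (2 * n%:R + a + c))
       (1 / 2 * (2 * n%:R + a + 2 * b + c))
       (fun s : R => sigma s n a b c) t).
Proof.
split=> [alpha beta n t alpha1 t01|n a b c t a1 b1 t01]; last exact: sigma_painleve.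
have pq0 : (n <= n <= n.+1)%N by rewrite leqnn leqnSn.
have pq1 : (n <= n.+1 <= n.+1)%N by rewrite leqnSn leqnn.
have [even Heven] := log_hankel_w_sym beta alpha1 t01 pq0.
have [odd Hodd] := log_hankel_w_sym beta alpha1 t01 pq1.
have -> : (2 * n + 1 = n.+1 + n)%N by rewrite addn1 mul2n -addnn.
rewrite mul2n -addnn addn1; split => //.
- rewrite Heven /sigma; move: (hankel_H _ _ _ _) (hankel_H _ _ _ _) => H1 H2.
  by field.
- rewrite Hodd /sigma -natr1; move: (hankel_H _ _ _ _) (hankel_H _ _ _ _) => H1 H2.
  by field.
Qed.
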